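(* Let $\mathcal{G}=\langle\mathcal{Q},\mathbf{f}\rangle$ be a P$_{\boldsymbol{\Upsilon}}$ NEP. Then $\mathcal{G}$ has a unique NE $\mathbf{x}^\star$, and every sequence $\{\mathbf{x}^{(n)}\}_{n\ge0}$ generated by the asynchronous best-response algorithm converges to $\mathbf{x}^\star$, for any updating schedule $\{\mathcal{T}_i\}$, $\{\tau_j^i(n)\}$ satisfying A1–A3.
   Context: Real NEP $\mathcal{G}=\langle\mathcal{Q},\mathbf{f}\rangle$: $I$ players; player $i$ chooses $\mathbf{x}_i\in\mathcal{Q}_i\subseteq\mathbb{R}^{n_i}$; $\mathbf{x}=(\mathbf{x}_i)_{i=1}^I$, $\mathbf{x}_{-i}=(\mathbf{x}_j)_{j\ne i}$, $\mathcal{Q}=\prod_i\mathcal{Q}_i$, $\mathcal{Q}_{-i}=\prod_{j\ne i}\mathcal{Q}_j$; player $i$ minimizes $f_i(\mathbf{x}_i,\mathbf{x}_{-i})$ over $\mathbf{x}_i\in\mathcal{Q}_i$. A NE is $\mathbf{x}^\star\in\mathcal{Q}$ with $f_i(\mathbf{x}_i^\star,\mathbf{x}^\star_{-i})\le f_i(\mathbf{x}_i,\mathbf{x}^\star_{-i})$ for all $\mathbf{x}_i\in\mathcal{Q}_i$ and all $i$. Assumption 1: each $\mathcal{Q}_i$ nonempty closed convex, each $f_i$ continuously differentiable on (an open set containing) $\mathcal{Q}$ and convex in $\mathbf{x}_i$ for every fixed $\mathbf{x}_{-i}\in\mathcal{Q}_{-i}$. Assumption 2: each $f_i$ twice continuously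 differentiable with bounded derivatives on $\mathcal{Q}$. Let $\mathbf{F}=(\mathbf{F}_i)_i$, $\mathbf{F}_i(\mathbf{x})=\nabla_{\mathbf{x}_i}f_i(\mathbf{x})$. Matrix $\boldsymbol{\Upsilon}_{\mathbf{F}}\in\mathbb{R}^{I\times I}$: for arbitrary nonsingular $\mathbf{C}_i\in\mathbb{R}^{n_i\times n_i}$, $[\boldsymbol{\Upsilon}_{\mathbf{F}}]_{ii}=\alpha_i^{\min}=\inf_{\mathbf{x}\in\mathcal{Q}}\lambda_{\rm least}(\mathbf{C}_i^T\mathbf{J}_i\mathbf{F}_i(\mathbf{x})\mathbf{C}_i)$, $[\boldsymbol{\Upsilon}_{\mathbf{F}}]_{ij}=-\beta_{ij}^{\max}=-\sup_{\mathbf{x}\in\mathcal{Q}}\|\mathbf{C}_i^T\mathbf{J}_j\mathbf{F}_i(\mathbf{x})\mathbf{C}_j\|_2$ ($i\ne j$), where $\mathbf{J}_j\mathbf{F}_i$ is the Jacobian of $\mathbf{F}_i$ w.r.t. $\mathbf{x}_j$ and $\lambda_{\rm least}(\mathbf{A})$ the smallest eigenvalue of $(\mathbf{A}+\mathbf{A}^T)/2$. $\mathcal{G}$ is a P$_{\boldsymbol{\Upsilon}}$ NEP if Assumptions 1 and 2 hold and $\boldsymbol{\Upsilon}_{\mathbf{F}}$ is a P-matrix (all principal minors positive). Asynchronous best-response algorithm: pick $\mathbf{x}^{(0)}\in\mathcal{Q}$; for $n=0,1,\dots$ and each $i$, set $\mathbf{x}_i^{(n+1)}\in\arg\min_{\mathbf{x}_i\in\mathcal{Q}_i}f_i(\mathbf{x}_i,\mathbf{x}_{-i}^{(\boldsymbol\tau^i(n))})$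 if $n\in\mathcal{T}_i$ and $\mathbf{x}_i^{(n+1)}=\mathbf{x}_i^{(n)}$ otherwise, where $\mathcal{T}_i\subseteq\{0,1,2,\dots\}$ is the set of update times of player $i$ and $\mathbf{x}_{-i}^{(\boldsymbol\tau^i(n))}=(\mathbf{x}_j^{(\tau_j^i(n))})_{j\ne i}$. Conditions: A1) $0\le\tau_j^i(n)\le n$; A2) $\lim_{k\to\infty}\tau_j^i(n_k)=+\infty$ for every sequence $\{n_k\}\subseteq\mathcal{T}_i$ tending to infinity; A3) $|\mathcal{T}_i|=\infty$. *)

(* Defs.v *)
From Stdlib Require Import Reals Lra Lia List Sorted.
Open Scope R_scope.

(** * Vectors and strategy profiles
    A vector of R^m is represented by [v : nat -> R] with [v k = 0] for [k >= m]
    (zero padding).  A strategy profile [x : prof] has components [x i : vec],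
    [x i] is the strategy of player [i] (for [i < I]); components [i >= I] are 0. *)
Definition vec := nat -> R.
Definition prof := nat -> vec.

Fixpoint sumR (m : nat) (g : nat -> R) : R :=
  match m with O => 0 | S p => sumR p g + g p end.

Definition in_Rn (m : nat) (v : vec) : Prop := forall k, (m <= k)%nat -> v k = 0.

Definition norm2 (m : nat) (v : vec) : R := sqrt (sumR m (fun k => v k * v k)).

Definition in_E (I : nat) (n : nat -> nat) (x : prof) : Prop :=
  forall i, ((i < I)%nat -> in_Rn (n i) (x i)) /\ ((I <= i)%nat -> forall k, x i k = 0).

Definition pdist (I : nat) (n : nat -> nat) (x y : prof) : R :=
  sqrt (sumR I (fun i => sumR (n i) (fun k => (x i k - y i k) * (x i k - y i k)))).

Definition memQ (n : nat -> nat) (Q : nat -> vec -> Prop) (i : nat) (v : vec) : Prop :=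
  in_Rn (n i) v /\ Q i v.

Definition inQ (I : nat) (n : nat -> nat) (Q : nat -> vec -> Prop) (x : prof) : Prop :=
  in_E I n x /\ forall i, (i < I)%nat -> Q i (x i).

Definition upd (x : prof) (i : nat) (y : vec) : prof :=
  fun j => if Nat.eq_dec j i then y else x j.

Definition pshift (x : prof) (j l : nat) (t : R) : prof :=
  upd x j (fun k => if Nat.eq_dec k l then x j k + t else x j k).

Definition vconv (m : nat) (u : nat -> vec) (v : vec) : Prop :=
  forall eps, eps > 0 -> exists N, forall p, (N <= p)%nat ->
    norm2 m (fun k => u p k - v k) < eps.

Definition closed_in (m : nat) (S : vec -> Prop) : Prop :=
  forall u v, (forall p, S (u p)) -> in_Rn m v -> vconv m u v -> S v.

Definition convex_set (S : vec -> Prop) : Prop :=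
  forall u v t, S u -> S v -> 0 <= t <= 1 -> S (fun k => t * u k + (1 - t) * v k).

Definition open_E (I : nat) (n : nat -> nat) (U : prof -> Prop) : Prop :=
  forall x, U x -> exists d, d > 0 /\
    forall y, in_E I n y -> pdist I n x y < d -> U y.

Definition cont_on (I : nat) (n : nat -> nat) (U : prof -> Prop) (g : prof -> R) : Prop :=
  forall x, U x -> forall eps, eps > 0 -> exists d, d > 0 /\
    forall y, U y -> pdist I n x y < d -> Rabs (g y - g x) < eps.

Definition vidx (I : nat) (n : nat -> nat) (j l : nat) : Prop := (j < I)%nat /\ (l < n j)%nat.

Definition is_partial (g : prof -> R) (x : prof) (j l : nat) (d : R) : Prop :=
  derivable_pt_lim (fun t => g (pshift x j l t)) 0 d.

Definition C1_with (I : nat) (n : nat -> nat) (U : prof -> Prop) (g : prof -> R)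
  (D : nat -> nat -> prof -> R) : Prop :=
  forall j l, vidx I n j l ->
    (forall x, U x -> is_partial g x j l (D j l x)) /\ cont_on I n U (D j l).

Definition matvec (p : nat) (A : nat -> nat -> R) (v : vec) : vec :=
  fun a => sumR p (fun b => A a b * v b).

Fixpoint det (m : nat) (A : nat -> nat -> R) : R :=
  match m with
  | O => 1
  | S p => sumR (S p) (fun j => (-1) ^ j * A 0%nat j *
             det p (fun a b => A (S a) (if (b <? j)%nat then b else S b)))
  end.

Definition Pmatrix (m : nat) (A : nat -> nat -> R) : Prop :=
  forall s : list nat, s <> nil -> Sorted lt s -> (forall a, In a s -> (a < m)%nat) ->
    det (length s) (fun a b => A (nth a s 0%nat) (nth b s 0%nat)) > 0.

Definition nonsing (m : nat) (C : nat -> nat -> R) : Prop :=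
  forall v, in_Rn m v -> (forall a, (a < m)%nat -> matvec m C v a = 0) -> forall a, v a = 0.

Definition is_eigval (m : nat) (S : nat -> nat -> R) (lam : R) : Prop :=
  exists v, in_Rn m v /\ (exists a, (a < m)%nat /\ v a <> 0) /\
    forall a, (a < m)%nat -> matvec m S v a = lam * v a.

Definition symp (A : nat -> nat -> R) : nat -> nat -> R := fun a b => (A a b + A b a) / 2.

Definition is_lambda_least (m : nat) (A : nat -> nat -> R) (lam : R) : Prop :=
  is_eigval m (symp A) lam /\ forall mu, is_eigval m (symp A) mu -> lam <= mu.

Definition is_norm2 (m p : nat) (A : nat -> nat -> R) (s : R) : Prop :=
  is_lub (fun r => exists v, in_Rn p v /\ norm2 p v = 1 /\ r = norm2 m (matvec p A v)) s.

Definition is_glb (E : R -> Prop) (l : R) : Prop :=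
  (forall r, E r -> l <= r) /\ (forall b, (forall r, E r -> b <= r) -> b <= l).

(** C_i^T J_j F_i(x) C_j, where (J_j F_i(x))_{k,l} = d/dx_{j,l} (d f_i/dx_{i,k}) = D2 i i k j l x *)
Definition blk (n : nat -> nat) (C : nat -> nat -> nat -> R)
  (D2 : nat -> nat -> nat -> nat -> nat -> prof -> R) (i j : nat) (x : prof) : nat -> nat -> R :=
  fun a b => sumR (n i) (fun k => sumR (n j) (fun l => C i k a * D2 i i k j l x * C j l b)).

Definition Assumption1 (I : nat) (n : nat -> nat) (Q : nat -> vec -> Prop) (f : nat -> prof -> R) : Prop :=
  (forall i, (i < I)%nat ->
     (exists v, memQ n Q i v) /\ closed_in (n i) (memQ n Q i) /\ convex_set (memQ n Q i)) /\
  (exists U D1, open_E I n U /\ (forall x, inQ I n Q x -> U x) /\ (forall x, U x -> in_E I n x) /\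
     forall i, (i < I)%nat -> C1_with I n U (f i) (D1 i)) /\
  (forall i, (i < I)%nat -> forall x, inQ I n Q x -> forall u v t,
     memQ n Q i u -> memQ n Q i v -> 0 <= t <= 1 ->
     f i (upd x i (fun k => t * u k + (1 - t) * v k))
       <= t * f i (upd x i u) + (1 - t) * f i (upd x i v)).

(** P_Upsilon NEP: Assumptions 1 and 2 hold and Upsilon_F (for some choice of nonsingular C_i)
    is a P-matrix.  D1 i j l = d f_i / d x_{j,l};  D2 i j l j' l' = d (D1 i j l) / d x_{j',l'}. *)
Definition PUps_NEP (I : nat) (n : nat -> nat) (Q : nat -> vec -> Prop) (f : nat -> prof -> R) : Prop :=
  (forall i, (i < I)%nat -> (0 < n i)%nat) /\
  Assumption1 I n Q f /\
  exists (U : prof -> Prop) (D1 : nat -> nat -> nat -> prof -> R)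
         (D2 : nat -> nat -> nat -> nat -> nat -> prof -> R),
    open_E I n U /\ (forall x, inQ I n Q x -> U x) /\ (forall x, U x -> in_E I n x) /\
    (forall i, (i < I)%nat ->
       C1_with I n U (f i) (D1 i) /\
       (forall j l, vidx I n j l -> C1_with I n U (D1 i j l) (D2 i j l))) /\
    (exists M, forall i j l, (i < I)%nat -> vidx I n j l -> forall x, inQ I n Q x ->
        Rabs (D1 i j l x) <= M /\
        forall j' l', vidx I n j' l' -> Rabs (D2 i j l j' l' x) <= M) /\
    exists (C : nat -> nat -> nat -> R) (alpha : nat -> R) (beta : nat -> nat -> R),
      (forall i, (i < I)%nat -> nonsing (n i) (C i)) /\
      (forall i, (i < I)%nat ->
         is_glb (fun r => exists x, inQ I n Q x /\ is_lambda_least (n i) (blk n C D2 i i x) r)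
                (alpha i)) /\
      (forall i j, (i < I)%nat -> (j < I)%nat -> i <> j ->
         is_lub (fun r => exists x, inQ I n Q x /\ is_norm2 (n i) (n j) (blk n C D2 i j x) r)
                (beta i j)) /\
      Pmatrix I (fun a b => if Nat.eq_dec a b then alpha a else - beta a b).

Definition is_NE (I : nat) (n : nat -> nat) (Q : nat -> vec -> Prop) (f : nat -> prof -> R)
  (xs : prof) : Prop :=
  inQ I n Q xs /\
  forall i, (i < I)%nat -> forall y, memQ n Q i y -> f i xs <= f i (upd xs i y).

(** * Asynchronous best-response algorithm.
    [T i m] : m is an update time of player i;  [tau i j m] = tau_j^i(m). *)
Definition async_BR (I : nat) (n : nat -> nat) (Q : nat -> vec -> Prop) (f : nat -> prof -> R)
  (T : nat -> nat -> Prop) (tau : nat -> nat -> nat -> nat) (x : nat -> prof) : Prop :=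
  inQ I n Q (x 0%nat) /\
  forall m i,
    ((I <= i)%nat -> x (S m) i = x m i) /\
    ((i < I)%nat ->
       (T i m ->
          memQ n Q i (x (S m) i) /\
          forall y, memQ n Q i y ->
            f i (upd (fun j => x (tau i j m) j) i (x (S m) i))
              <= f i (upd (fun j => x (tau i j m) j) i y)) /\
       (~ T i m -> x (S m) i = x m i)).

Definition sched_A1 (I : nat) (tau : nat -> nat -> nat -> nat) : Prop :=
  forall i j m, (i < I)%nat -> (j < I)%nat -> j <> i -> (tau i j m <= m)%nat.

Definition sched_A2 (I : nat) (T : nat -> nat -> Prop) (tau : nat -> nat -> nat -> nat) : Prop :=
  forall i j, (i < I)%nat -> (j < I)%nat -> j <> i ->
  forall nk : nat -> nat, (forall k, T i (nk k)) ->
    (forall M, exists K, forall k, (K <= k)%nat -> (M <= nk k)%nat) ->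
    forall M, exists K, forall k, (K <= k)%nat -> (M <= tau i j (nk k))%nat.

Definition sched_A3 (I : nat) (T : nat -> nat -> Prop) : Prop :=
  forall i, (i < I)%nat -> forall M, exists m, (M <= m)%nat /\ T i m.

(* Main.v *)
(** A positive vector w with Upsilon w > 0 exists because Upsilon is both a P-matrix and a
    Z-matrix; it turns the estimate
      alpha_i |C_i^-1 (u_i - v_i)| <= sum_{j <> i} beta_ij |C_j^-1 (x_j - y_j)|
    between best responses u_i to x and v_i to y into a contraction for the w-weighted maximum of
    the norms |C_i^-1 .|.  The estimate itself comes from adding the two first-order optimality
    conditions and applying the mean value theorem to the slope of f_i along the segment joining
    the two profiles.  Best responses exist by strong convexity, the equilibrium is the limit of
    the simultaneous iteration, and under A1-A3 the asynchronous iterates enter for good the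
    weighted box of radius B rho^k around it, for every k. *)

Require Import Defs.
From Stdlib Require Import Reals Lra Lia List Sorted FinFun.
From Stdlib Require Import Classical ClassicalChoice FunctionalExtensionality.
From mathcomp Require all_boot all_algebra Rstruct.
Open Scope R_scope.

(** * Determinants and inverses *)

(** Three obstacles shape the argument. The sets Q_i may be unbounded, so compactness is never
    available: infima, the least eigenvalue among them, come from completeness of the reals, limits
    come from Cauchy sequences, and the curvature alpha_i > 0, read off the 1 x 1 minors, supplies
    coercivity. The mean value theorem fails for the vector map F, so it is applied to the scalar s
    -> F_i(x + s(y - x)) . d_i with d_i = y_i - x_i frozen; a single intermediate profile then
    serves all Jacobian blocks of row i, and by convexity it lies in Q, where alpha_i and beta_ij
    are valid bounds. Smoothness is given through partial derivatives only, while segments between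
    profiles are oblique; differentiability along them has to be derived from continuity of the
    partials on the open set U. The scaling enters through u = C_i z_i and v = C_j z_j, for which u
    . J v = z_i . (C_i^T J C_j) z_j: bounds on the scaled blocks become bounds on the Jacobian
    itself in the norms |C_i^-1 .|. A rate rho < 1 exists because the finitely many strict
    inequalities (Upsilon w)_i > 0 leave a common relative slack. *)

Module MatrixFacts.
Import ssreflect all_boot all_algebra Rstruct.
Import GRing.Theory.

Lemma sumR_big m g : sumR m g = (\sum_(i < m) g (nat_of_ord i))%R.
Proof.
elim: m => [|m IH] /=; first by rewrite big_ord0.
by rewrite big_ord_recr /= -IH.
Qed.

Definition to_mx m (A : nat -> nat -> R) : 'M[R]_m := (\matrix_(i, j) A i j)%R.

(** The recursive [det] is the Laplace expansion along row 0, and its column skip [b <? j] is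
    MathComp's [bump]. The bridge makes multiplicativity of determinants available for
    [det_schur]. *)
Lemma det_to_mx m A : det m A = (\det (to_mx m A))%R.
Proof.
elim: m A => [|m IH] A; first by rewrite det_mx00.
rewrite (expand_det_row _ ord0).
cbn [det]; rewrite sumR_big; apply: eq_bigr => j _.
rewrite /cofactor mxE add0n IH RpowE.
rewrite [LHS]RmultE RmultE mulrAC [RHS]mulrC; congr (_ * _ * _)%R.
congr (\det _)%R; apply/matrixP => a b; rewrite !mxE /=.
congr (A _ _); rewrite /bump.
case: PeanoNat.Nat.ltb_spec => /ssrnat.leP; last by move=> ->.
by rewrite ltnNge => /negbTE ->.
Qed.

Lemma det_schur m A : A 0%nat 0%nat <> 0 ->
  det (S m) A = A 0%nat 0%nat *
    det m (fun a b => A (S a) (S b) - A (S a) 0%nat * A 0%nat (S b) / A 0%nat 0%nat).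
Proof.
move=> /eqP a0; rewrite !det_to_mx.
set a := A _ _ in a0 *.
pose r : 'rV[R]_m := (\row_j A 0%nat (S j))%R.
pose c : 'cV[R]_m := (\col_j A (S j) 0%nat)%R.
pose D : 'M[R]_m := (\matrix_(i, j) A (S i) (S j))%R.
have -> : to_mx m.+1 A = (block_mx (a%:M : 'M_1) r c D)%R.
  apply/matrixP => i j; rewrite !mxE.
  case: splitP => i' Ei; rewrite !mxE; case: splitP => j' Ej; rewrite !mxE Ei Ej.
  - by rewrite !ord1 eqxx mulr1n.
  - by rewrite ord1.
  - by rewrite ord1.
  - by [].
(* Column operations of determinant 1 clear the rest of row 0; what remains is block lower
   triangular with the Schur complement as its second diagonal block. *)
have E : (block_mx (a%:M : 'M_1) r c D *m block_mx 1%:M (- (a^-1 *: r)) 0 1%:M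
   = block_mx (a%:M : 'M_1) 0 c (D - a^-1 *: (c *m r)))%R.
  rewrite mulmx_block !mulmx1 !mulmx0 !addr0 mulmxN mul_scalar_mx scalerA divff //.
  by rewrite scale1r addNr mulmxN -scalemxAr [(- _ + D)%R]addrC.
have := congr1 determinant E.
rewrite det_mulmx det_ublock !det1 !mulr1 det_lblock det_scalar1 => ->.
congr (_ * \det _)%R; apply/matrixP => i j.
by rewrite !mxE big_ord1 !mxE mulrC.
Qed.

Lemma nonsing_right_inverse m C : nonsing m C ->
  exists D, forall v k, (k < m)%coq_nat -> matvec m C (matvec m D v) k = v k.
Proof.
move=> hC.
have U : (to_mx m C \in unitmx)%R.
  rewrite -unitmx_tr -row_free_unit; apply: inj_row_free => v hv.
  (* [nonsing] is injectivity on zero-padded vectors, so the row vector [v] is padded with 0 before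
     it can be tested. *)
  pose w : vec := fun k => if insub k is Some i then v 0%R i else 0.
  have wE (i : 'I_m) : w i = v 0%R i by rewrite /w valK.
  have w0 : forall a, w a = 0.
    apply: hC => [k /ssrnat.leP hk | a /ssrnat.ltP ha].
      by rewrite /w insubF // ltnNge hk.
    rewrite /matvec sumR_big.
    move/matrixP: hv => /(_ 0%R (Ordinal ha)); rewrite !mxE; apply: etrans.
    by apply: eq_bigr => i _; rewrite !mxE wE RmultE mulrC.
  by apply/rowP => i; rewrite mxE -wE.
(* The default 0 outside the m x m range is harmless: for k < m both products read only entries in
   range. *)
pose D := fun a b => match insub a, insub b with
  | Some i, Some j => invmx (to_mx m C) i j | _, _ => 0 end.
have DE (i j : 'I_m) : D i j = invmx (to_mx m C) i j by rewrite /D !valK.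
exists D => v k /ssrnat.ltP hk.
have := mulmxA (to_mx m C) (invmx (to_mx m C)) (\col_(j < m) v j)%R.
rewrite mulmxV // mul1mx => /matrixP /(_ (Ordinal hk) 0%R).
rewrite !mxE => <-.
rewrite /matvec sumR_big; apply: eq_bigr => i _; rewrite !mxE RmultE; congr (_ * _)%R.
by rewrite sumR_big; apply: eq_bigr => j _; rewrite !mxE DE.
Qed.
End MatrixFacts.
Import MatrixFacts.

(** * Finite sums, norms and quadratic forms *)

Lemma sumR_ext m f g : (forall k, (k < m)%nat -> f k = g k) -> sumR m f = sumR m g.
Proof.
  induction m as [|m IH]; intros h; simpl; [reflexivity|].
  rewrite IH by (intros; apply h; lia). rewrite h by lia. reflexivity.
Qed.

Lemma sumR_plus m f g : sumR m (fun k => f k + g k) = sumR m f + sumR m g.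
Proof. induction m as [|m IH]; simpl; [|rewrite IH]; lra. Qed.

Lemma sumR_minus m f g : sumR m (fun k => f k - g k) = sumR m f - sumR m g.
Proof. induction m as [|m IH]; simpl; [|rewrite IH]; lra. Qed.

Lemma sumR_scal m c f : sumR m (fun k => c * f k) = c * sumR m f.
Proof. induction m as [|m IH]; simpl; [|rewrite IH]; lra. Qed.

Lemma sumR_scal_r m c f : sumR m (fun k => f k * c) = sumR m f * c.
Proof. induction m as [|m IH]; simpl; [|rewrite IH]; lra. Qed.

Lemma sumR_0 m f : (forall k, (k < m)%nat -> f k = 0) -> sumR m f = 0.
Proof.
  intros h. rewrite (sumR_ext m f (fun _ => 0 * 0)) by (intros; rewrite h by auto; ring).
  rewrite sumR_scal. ring.
Qed.

Lemma sumR_le m f g : (forall k, (k < m)%nat -> f k <= g k) -> sumR m f <= sumR m g.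
Proof.
  induction m as [|m IH]; intros h; simpl; [lra|].
  assert (sumR m f <= sumR m g) by (apply IH; intros; apply h; lia).
  assert (f m <= g m) by (apply h; lia). lra.
Qed.

Lemma sumR_nonneg m f : (forall k, (k < m)%nat -> 0 <= f k) -> 0 <= sumR m f.
Proof.
  intros h. rewrite <- (sumR_0 m (fun _ => 0)) by auto. apply sumR_le; auto.
Qed.

Lemma sumR_term_le m f k : (forall j, (j < m)%nat -> 0 <= f j) -> (k < m)%nat -> f k <= sumR m f.
Proof.
  induction m as [|m IH]; intros h hk; simpl; [lia|].
  destruct (Nat.eq_dec k m) as [->|ne].
  - assert (0 <= sumR m f) by (apply sumR_nonneg; intros; apply h; lia). lra.
  - assert (f k <= sumR m f) by (apply IH; [intros; apply h|]; lia).
    assert (0 <= f m) by (apply h; lia). lra.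
Qed.

Lemma sumR_Rabs m f : Rabs (sumR m f) <= sumR m (fun k => Rabs (f k)).
Proof.
  induction m as [|m IH]; simpl; [rewrite Rabs_R0; lra|].
  pose proof (Rabs_triang (sumR m f) (f m)). lra.
Qed.

Lemma sumR_S_first m f : sumR (S m) f = f 0%nat + sumR m (fun k => f (S k)).
Proof. induction m as [|m IH]; [simpl; ring|]. cbn [sumR] in *. rewrite IH. ring. Qed.

Lemma sumR_swap m p f :
  sumR m (fun a => sumR p (fun b => f a b)) = sumR p (fun b => sumR m (fun a => f a b)).
Proof.
  induction m as [|m IH]; simpl; [symmetry; apply sumR_0; auto|].
  rewrite IH, <- sumR_plus. reflexivity.
Qed.

Lemma sumR_const m c : sumR m (fun _ => c) = INR m * c.
Proof. induction m as [|m IH]; [simpl; ring|]. cbn [sumR]. rewrite IH, S_INR. ring. Qed.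

Definition dot m (u v : vec) := sumR m (fun k => u k * v k).

Lemma dot_self_nonneg m v : 0 <= dot m v v.
Proof. apply sumR_nonneg; intros; nra. Qed.

Lemma dot_self_zero m v : dot m v v = 0 -> forall k, (k < m)%nat -> v k = 0.
Proof.
  intros h k hk.
  assert (v k * v k <= dot m v v).
  { apply (sumR_term_le m (fun k => v k * v k)); [intros; nra|auto]. }
  nra.
Qed.

Lemma dot_lin_comb_sq m u v s t :
  dot m (fun k => s * u k + t * v k) (fun k => s * u k + t * v k) =
  s * s * dot m u u + 2 * s * t * dot m u v + t * t * dot m v v.
Proof. unfold dot. rewrite <- !sumR_scal, <- !sumR_plus. apply sumR_ext; intros; ring. Qed.

Lemma Cauchy_Schwarz_sq m u v : dot m u v * dot m u v <= dot m u u * dot m v v.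
Proof.
  pose proof (dot_self_nonneg m u) as hu. pose proof (dot_self_nonneg m v) as hv.
  (* This combination is [dot m v v] times the component of [u] orthogonal to [v], which avoids a
     division until the final cancellation. *)
  pose proof (dot_lin_comb_sq m u v (dot m v v) (- dot m u v)) as E.
  pose proof (dot_self_nonneg m (fun k => dot m v v * u k + - dot m u v * v k)) as h.
  rewrite E in h.
  destruct (Req_dec (dot m v v) 0) as [e|ne].
  - replace (dot m u v) with 0; [nra|]. symmetry; apply sumR_0.
    intros k hk. rewrite (dot_self_zero m v e k hk). ring.
  - assert (0 < dot m v v) by lra.
    apply Rmult_le_reg_l with (dot m v v); [lra|]. nra.
Qed.

Lemma norm2_nonneg m v : 0 <= norm2 m v.
Proof. apply sqrt_pos. Qed.

Lemma norm2_sq m v : norm2 m v * norm2 m v = dot m v v.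
Proof. apply sqrt_sqrt, dot_self_nonneg. Qed.

Lemma norm2_ext m u v : (forall k, (k < m)%nat -> u k = v k) -> norm2 m u = norm2 m v.
Proof. intros h. unfold norm2. f_equal. apply sumR_ext. intros; rewrite h; auto. Qed.

Lemma sq_le_le x y : 0 <= y -> x * x <= y * y -> x <= y.
Proof. intros; nra. Qed.

Lemma Cauchy_Schwarz m u v : Rabs (dot m u v) <= norm2 m u * norm2 m v.
Proof.
  pose proof (norm2_nonneg m u). pose proof (norm2_nonneg m v).
  apply sq_le_le; [nra|].
  rewrite <- Rabs_mult, Rabs_pos_eq by nra.
  replace (norm2 m u * norm2 m v * (norm2 m u * norm2 m v))
    with ((norm2 m u * norm2 m u) * (norm2 m v * norm2 m v)) by ring.
  rewrite !norm2_sq. apply Cauchy_Schwarz_sq.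
Qed.

Lemma norm2_scal m c v : norm2 m (fun k => c * v k) = Rabs c * norm2 m v.
Proof.
  unfold norm2. rewrite <- (sqrt_Rsqr_abs c), <- sqrt_mult_alt by apply Rle_0_sqr.
  f_equal. rewrite <- sumR_scal. apply sumR_ext; intros; unfold Rsqr; ring.
Qed.

Lemma norm2_triang m u v : norm2 m (fun k => u k + v k) <= norm2 m u + norm2 m v.
Proof.
  pose proof (norm2_nonneg m u). pose proof (norm2_nonneg m v).
  apply sq_le_le; [lra|].
  rewrite norm2_sq.
  pose proof (dot_lin_comb_sq m u v 1 1) as E.
  replace (fun k => 1 * u k + 1 * v k) with (fun k => u k + v k) in E
    by (apply functional_extensionality; intro; ring).
  rewrite E.
  pose proof (Cauchy_Schwarz m u v). pose proof (Rle_abs (dot m u v)).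
  rewrite <- !norm2_sq. nra.
Qed.

Lemma norm2_coord m v k : (k < m)%nat -> Rabs (v k) <= norm2 m v.
Proof.
  intros hk. apply sq_le_le; [apply norm2_nonneg|].
  rewrite norm2_sq, <- Rabs_mult, Rabs_pos_eq by nra.
  apply (sumR_term_le m (fun k => v k * v k)); [intros; nra|auto].
Qed.

Lemma norm2_le_coord m v r : 0 <= r -> (forall k, (k < m)%nat -> Rabs (v k) <= r) ->
  norm2 m v <= INR m * r.
Proof.
  intros hr h.
  assert (hs : 0 <= INR m * r) by (apply Rmult_le_pos; [apply pos_INR|auto]).
  apply sq_le_le; [auto|]. rewrite norm2_sq.
  apply Rle_trans with (sumR m (fun _ => r * r)).
  - apply sumR_le. intros k hk. specialize (h k hk).
    pose proof (Rabs_pos (v k)).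
    replace (v k * v k) with (Rabs (v k) * Rabs (v k))
      by (rewrite <- Rabs_mult; apply Rabs_pos_eq; nra). nra.
  - rewrite sumR_const. destruct m as [|m]; [simpl; lra|].
    pose proof (pos_INR m). rewrite S_INR in *. nra.
Qed.

Lemma matvec_ext p A u v a : (forall k, (k < p)%nat -> u k = v k) -> matvec p A u a = matvec p A v a.
Proof. intros h. apply sumR_ext; intros; rewrite h; auto. Qed.

Lemma matvec_lin p A u v s t a :
  matvec p A (fun k => s * u k + t * v k) a = s * matvec p A u a + t * matvec p A v a.
Proof. unfold matvec. rewrite <- !sumR_scal, <- sumR_plus. apply sumR_ext; intros; ring. Qed.

Lemma matvec_scal p A c v a : matvec p A (fun k => c * v k) a = c * matvec p A v a.
Proof. unfold matvec. rewrite <- sumR_scal. apply sumR_ext; intros; ring. Qed.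

Lemma matvec_minus p A u v a :
  matvec p A (fun k => u k - v k) a = matvec p A u a - matvec p A v a.
Proof. unfold matvec. rewrite <- sumR_minus. apply sumR_ext; intros; ring. Qed.

Lemma matvec_bounded m p A :
  exists K, 0 < K /\ forall v, norm2 m (matvec p A v) <= K * norm2 p v.
Proof.
  (* [F] is the squared Frobenius norm; the 1 added to its root keeps the constant positive for the
     zero matrix too. *)
  set (F := sumR m (fun a => dot p (A a) (A a))).
  assert (hF : 0 <= F) by (apply sumR_nonneg; intros; apply dot_self_nonneg).
  exists (sqrt F + 1). pose proof (sqrt_pos F) as hs. split; [lra|]. intros v.
  pose proof (norm2_nonneg p v) as hv.
  assert (h : norm2 m (matvec p A v) <= sqrt F * norm2 p v); [|nra].
  apply sq_le_le; [nra|].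
  replace (sqrt F * norm2 p v * (sqrt F * norm2 p v))
    with ((sqrt F * sqrt F) * (norm2 p v * norm2 p v)) by ring.
  rewrite sqrt_sqrt, !norm2_sq by auto.
  unfold F. rewrite <- sumR_scal_r. apply sumR_le. intros a _. apply Cauchy_Schwarz_sq.
Qed.

Definition trunc (m : nat) (v : vec) : vec := fun k => if Nat.ltb k m then v k else 0.

Lemma trunc_in_Rn m v : in_Rn m (trunc m v).
Proof. intros k hk. unfold trunc. destruct (Nat.ltb_spec k m); [lia|reflexivity]. Qed.

Lemma trunc_eq m v k : (k < m)%nat -> trunc m v k = v k.
Proof. intros hk. unfold trunc. destruct (Nat.ltb_spec k m); [reflexivity|lia]. Qed.

Definition basis0 : vec := fun k => match k with O => 1 | S _ => 0 end.

Lemma basis0_in_Rn m : (0 < m)%nat -> in_Rn m basis0.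
Proof. intros hm k hk. destruct k; [lia|reflexivity]. Qed.

Lemma dot_basis0 m : (0 < m)%nat -> dot m basis0 basis0 = 1.
Proof.
  intros hm. destruct m; [lia|]. unfold dot. rewrite sumR_S_first.
  rewrite sumR_0 by (intros; simpl; ring). simpl; ring.
Qed.

Lemma norm2_basis0 m : (0 < m)%nat -> norm2 m basis0 = 1.
Proof. intros hm. unfold norm2. fold (dot m basis0 basis0). rewrite dot_basis0 by auto. apply sqrt_1. Qed.

(** The supremum needs a unit vector to be taken over, hence the positive dimension [p]; [basis0] is
    that vector. *)
Lemma is_norm2_exists m p A : (0 < p)%nat -> exists s, is_norm2 m p A s.
Proof.
  intros hp. destruct (matvec_bounded m p A) as [K [hK h]].
  destruct (completeness (fun r => exists v, in_Rn p v /\ norm2 p v = 1 /\ r = norm2 m (matvec p A v)))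
    as [s hs].
  - exists K. intros r [v [_ [h1 ->]]]. specialize (h v). rewrite h1 in h. lra.
  - exists (norm2 m (matvec p A basis0)), basis0. split; [apply basis0_in_Rn; auto|].
    split; [apply norm2_basis0; auto|reflexivity].
  - exists s; exact hs.
Qed.

Lemma is_norm2_nonneg m p A s : (0 < p)%nat -> is_norm2 m p A s -> 0 <= s.
Proof.
  intros hp [hs _].
  apply Rle_trans with (norm2 m (matvec p A basis0)); [apply norm2_nonneg|].
  apply hs. exists basis0. split; [apply basis0_in_Rn; auto|].
  split; [apply norm2_basis0; auto|reflexivity].
Qed.

(** Homogeneity reduces to unit vectors. The supremum only sees zero-padded ones, so the normalised
    vector is truncated, which changes neither its norm nor its image. *)
Lemma is_norm2_bound m p A s v : is_norm2 m p A s ->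
  norm2 m (matvec p A v) <= s * norm2 p v.
Proof.
  intros [hs _]. set (N := norm2 p v).
  destruct (Req_dec N 0) as [e|ne].
  - rewrite e, Rmult_0_r. right. unfold norm2. rewrite sumR_0; [apply sqrt_0|].
    intros a ha. replace (matvec p A v a) with 0; [ring|].
    symmetry; apply sumR_0. intros k hk. rewrite (dot_self_zero p v); [ring| |auto].
    rewrite <- norm2_sq. fold N. rewrite e; ring.
  - assert (hN : 0 < N) by (pose proof (norm2_nonneg p v); fold N in H; lra).
    pose (w := fun k => / N * v k).
    assert (hw : norm2 p w = 1).
    { unfold w. rewrite norm2_scal, Rabs_pos_eq by (left; apply Rinv_0_lt_compat; lra).
      fold N. field; lra. }
    assert (h : norm2 m (matvec p A (trunc p w)) <= s).
    { apply hs. exists (trunc p w). split; [apply trunc_in_Rn|]. split; [|reflexivity].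
      rewrite <- hw. apply norm2_ext; intros; apply trunc_eq; auto. }
    rewrite (norm2_ext m _ (fun a => / N * matvec p A v a)) in h.
    + rewrite norm2_scal, Rabs_pos_eq in h by (left; apply Rinv_0_lt_compat; lra).
      apply Rmult_le_compat_r with (r := N) in h; [|lra].
      rewrite Rmult_comm, <- Rmult_assoc, Rinv_r, Rmult_1_l in h by lra. exact h.
    + intros a _. rewrite (matvec_ext p A _ w) by (intros; apply trunc_eq; auto).
      apply matvec_scal.
Qed.

(** * Quadratic forms and the least eigenvalue of the symmetric part *)

Definition quad m (A : nat -> nat -> R) (v : vec) := dot m v (matvec m A v).

Definition symmetric m (A : nat -> nat -> R) :=
  forall a b, (a < m)%nat -> (b < m)%nat -> A a b = A b a.

(** The same complement serves two eliminations: completing the square in a quadratic form, and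
    descending to a smaller P-matrix. *)
Definition schur (A : nat -> nat -> R) : nat -> nat -> R :=
  fun a b => A (S a) (S b) - A (S a) 0%nat * A 0%nat (S b) / A 0%nat 0%nat.

Lemma quad_complete_square m A v : symmetric (S m) A -> A 0%nat 0%nat <> 0 ->
  quad (S m) A v =
  A 0%nat 0%nat * Rsqr (v 0%nat + dot m (fun b => A 0%nat (S b)) (fun b => v (S b)) / A 0%nat 0%nat)
  + quad m (schur A) (fun b => v (S b)).
Proof.
  intros hA h0. set (d := dot m (fun b => A 0%nat (S b)) (fun b => v (S b))).
  set (Q := sumR m (fun a => v (S a) * sumR m (fun b => A (S a) (S b) * v (S b)))).
  assert (E1 : quad (S m) A v = A 0%nat 0%nat * v 0%nat * v 0%nat + 2 * v 0%nat * d + Q).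
  { unfold quad, dot, matvec. rewrite sumR_S_first, sumR_S_first.
    rewrite (sumR_ext m (fun k => v (S k) * sumR (S m) _) (fun k => v 0%nat * (A 0%nat (S k) * v (S k))
       + v (S k) * sumR m (fun b => A (S k) (S b) * v (S b)))).
    - rewrite sumR_plus, sumR_scal. unfold d, dot, Q. ring.
    - intros k hk. rewrite sumR_S_first. rewrite (hA 0%nat (S k)) by lia. ring. }
  assert (E2 : quad m (schur A) (fun b => v (S b)) = Q - d * d / A 0%nat 0%nat).
  { unfold quad, dot, matvec, schur.
    rewrite (sumR_ext m _ (fun k => v (S k) * sumR m (fun b => A (S k) (S b) * v (S b))
       - (A 0%nat (S k) * v (S k)) * (d / A 0%nat 0%nat))).
    - rewrite sumR_minus, sumR_scal_r. unfold Q. fold (dot m (fun b => A 0%nat (S b)) (fun b => v (S b))).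
      fold d. field; auto.
    - intros k hk. rewrite (hA 0%nat (S k)) by lia.
      rewrite (sumR_ext m _ (fun b => A (S k) (S b) * v (S b)
        - (A (S k) 0%nat / A 0%nat 0%nat) * (A 0%nat (S b) * v (S b)))).
      + rewrite sumR_minus, sumR_scal. unfold d, dot. field; auto.
      + intros; field; auto. }
  rewrite E1, E2. unfold Rsqr. field; auto.
Qed.

(* Completing the square reduces the dimension by one, so no compactness of the sphere is needed. *)
Lemma psd_null_or_coercive m A : symmetric m A -> (forall v, 0 <= quad m A v) ->
  (exists v, (exists a, (a < m)%nat /\ v a <> 0) /\ quad m A v = 0) \/
  (exists eps, eps > 0 /\ forall v, eps * dot m v v <= quad m A v).
Proof.
  revert A. induction m as [|m IH]; intros A hA hp.
  - right. exists 1. split; [lra|]. intros v. unfold quad, dot; simpl; lra.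
  - assert (E0 : quad (S m) A basis0 = A 0%nat 0%nat).
    { unfold quad, dot. rewrite sumR_S_first, sumR_0 by (intros; simpl; ring).
      unfold matvec. rewrite sumR_S_first, sumR_0 by (intros; simpl; ring). simpl; ring. }
    pose proof (hp basis0) as h0. rewrite E0 in h0.
    destruct (Req_dec (A 0%nat 0%nat) 0) as [e|ne].
    + left. exists basis0. split; [exists 0%nat; split; [lia|simpl; lra]|congruence].
    + set (a := A 0%nat 0%nat) in *. assert (ha : 0 < a) by lra.
      assert (hB : symmetric m (schur A)).
      { intros i j hi hj. unfold schur.
        rewrite (hA (S i) (S j)), (hA (S i) 0%nat), (hA 0%nat (S j)) by lia. unfold Rdiv; ring. }
      (* Coordinate 0 is chosen to annihilate the completed square, so [A] on [ext v] takes exactly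
         the value of the Schur complement on [v]. *)
      pose (ext := fun (v : vec) (k : nat) => match k with
         | O => - (dot m (fun b => A 0%nat (S b)) v / a) | S k => v k end).
      assert (Eext : forall v, quad (S m) A (ext v) = quad m (schur A) v).
      { intros v. rewrite quad_complete_square by auto. fold a.
        change (fun b => ext v (S b)) with v. unfold ext at 1. rewrite Rplus_opp_l. unfold Rsqr. ring. }
      destruct (IH (schur A) hB) as [[v [[k [hk hv]] e]]|[eps [heps h]]].
      * intros v. rewrite <- Eext. apply hp.
      * left. exists (ext v). split; [exists (S k); split; [lia|exact hv]|].
        rewrite Eext; exact e.
      * right. set (r := fun b => A 0%nat (S b)).
        set (K := dot m r r / (a * a)).
        assert (hK : 0 <= K).
        { apply Rmult_le_pos; [apply dot_self_nonneg|].
          left; apply Rinv_0_lt_compat; nra. }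
        (* With t^2 <= 2 (t + s)^2 + 2 s^2 and s^2 <= K N, the bound [a / 2] lets the pivot term
           absorb 2 e' (t + s)^2, and the second bound lets [eps] absorb e' (2 K + 1) N. *)
        set (e' := Rmin (a / 2) (eps / (2 * K + 1))).
        assert (he1 : e' <= a / 2) by apply Rmin_l.
        assert (he2 : e' * (2 * K + 1) <= eps).
        { apply Rle_trans with (eps / (2 * K + 1) * (2 * K + 1)).
          - apply Rmult_le_compat_r; [lra|apply Rmin_r].
          - right; field; lra. }
        assert (he : 0 < e').
        { apply Rmin_pos; [lra|]. apply Rdiv_lt_0_compat; lra. }
        exists e'. split; [lra|]. intros v.
        rewrite quad_complete_square by auto. fold a. fold r.
        set (v' := fun b => v (S b)). specialize (h v').
        set (s := dot m r v' / a).
        assert (hs : s * s <= K * dot m v' v').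
        { unfold s, K. pose proof (Cauchy_Schwarz_sq m r v') as hc.
          apply Rmult_le_compat_r with (r := / (a * a)) in hc;
            [|left; apply Rinv_0_lt_compat; nra].
          apply Rle_trans with (dot m r v' * dot m r v' * / (a * a)); [right; field; lra|].
          eapply Rle_trans; [exact hc|]. right; field; lra. }
        replace (dot (S m) v v) with (v 0%nat * v 0%nat + dot m v' v')
          by (unfold dot; rewrite sumR_S_first; reflexivity).
        set (N := dot m v' v') in *. assert (hN : 0 <= N) by apply dot_self_nonneg.
        unfold Rsqr. set (t := v 0%nat).
        assert (t * t <= 2 * ((t + s) * (t + s)) + 2 * (s * s))
          by (pose proof (Rle_0_sqr (t + 2 * s)) as hq; unfold Rsqr in hq; lra).
        assert (e' * (t * t) <= e' * (2 * ((t + s) * (t + s)) + 2 * (s * s)))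
          by (apply Rmult_le_compat_l; lra).
        assert (e' * (s * s) <= e' * (K * N)) by (apply Rmult_le_compat_l; lra).
        assert (e' * (2 * K + 1) * N <= eps * N) by (apply Rmult_le_compat_r; lra).
        assert (e' * ((t + s) * (t + s)) <= a / 2 * ((t + s) * (t + s)))
          by (apply Rmult_le_compat_r; [apply Rle_0_sqr|lra]).
        lra.
Qed.

Lemma matvec_transpose m A u v : symmetric m A -> dot m u (matvec m A v) = dot m v (matvec m A u).
Proof.
  intros hA. unfold dot, matvec.
  rewrite (sumR_ext m _ (fun a => sumR m (fun b => u a * (A a b * v b))))
    by (intros; rewrite sumR_scal; reflexivity).
  rewrite sumR_swap. apply sumR_ext. intros b hb. rewrite <- sumR_scal.
  apply sumR_ext. intros a ha. rewrite (hA a b) by auto. ring.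
Qed.

(** A zero of a nonnegative form is a minimum, so its first variation vanishes. Testing the
    direction z = A v with step t = - |z|^2 / c, where [c] is positive and at least [quad m A z],
    would give a negative value unless z = 0. *)
Lemma psd_null_vector m A v : symmetric m A -> (forall v, 0 <= quad m A v) -> quad m A v = 0 ->
  forall a, (a < m)%nat -> matvec m A v a = 0.
Proof.
  intros hA hp hv. set (z := matvec m A v). apply dot_self_zero.
  set (c := Rabs (quad m A z) + 1).
  assert (hc : 0 < c) by (unfold c; pose proof (Rabs_pos (quad m A z)); lra).
  set (N := dot m z z). assert (hN : 0 <= N) by apply dot_self_nonneg.
  set (t := - N / c).
  pose proof (hp (fun k => 1 * v k + t * z k)) as h.
  assert (E : quad m A (fun k => 1 * v k + t * z k) = 2 * t * N + t * t * quad m A z).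
  { assert (E : quad m A (fun k => 1 * v k + t * z k)
      = quad m A v + t * dot m v (matvec m A z) + t * dot m z z + t * t * quad m A z).
    { unfold quad, dot.
      rewrite (sumR_ext m _ (fun k => v k * matvec m A v k + t * (v k * matvec m A z k)
         + t * (z k * z k) + t * t * (z k * matvec m A z k))).
      - rewrite !sumR_plus, !sumR_scal. reflexivity.
      - intros k hk. rewrite matvec_lin. unfold z. ring. }
    rewrite E, hv, (matvec_transpose m A v z hA). fold z N. ring. }
  rewrite E in h.
  assert (quad m A z <= c) by (unfold c; pose proof (Rle_abs (quad m A z)); lra).
  assert (t * t * quad m A z <= t * t * c) by (apply Rmult_le_compat_l; nra).
  assert (E2 : 2 * t * N + t * t * c = - (N * N / c)) by (unfold t; field; lra).
  destruct (Req_dec N 0) as [|ne]; auto.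
  assert (0 < N * N / c) by (apply Rdiv_lt_0_compat; nra). lra.
Qed.

(** Take [lam] as the supremum of all l with l |v|^2 <= v . A v. The form of B = A - lam is
    nonnegative; were it coercive, [lam] could be raised. So it has a nontrivial zero, which
    [psd_null_vector] turns into an eigenvector. *)
Lemma least_eigenvalue_Rayleigh m A : (0 < m)%nat -> symmetric m A ->
  exists lam, is_eigval m A lam /\ forall v, lam * dot m v v <= quad m A v.
Proof.
  intros hm hA.
  destruct (matvec_bounded m m A) as [K [hK hb]].
  destruct (completeness (fun l => forall v, l * dot m v v <= quad m A v)) as [lam [hub hlub]].
  - exists (quad m A basis0). intros l hl. specialize (hl basis0).
    rewrite dot_basis0 in hl by auto. lra.
  - exists (- K). intros v. pose proof (Cauchy_Schwarz m v (matvec m A v)) as h.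
    fold (quad m A v) in h. specialize (hb v). pose proof (norm2_nonneg m v).
    rewrite <- norm2_sq. pose proof (Rle_abs (- quad m A v)) as h'. rewrite Rabs_Ropp in h'. nra.
  - assert (hlam : forall v, lam * dot m v v <= quad m A v).
    { intros v. pose proof (dot_self_nonneg m v).
      destruct (Req_dec (dot m v v) 0) as [e|ne].
      - rewrite e. replace (quad m A v) with 0; [lra|]. symmetry. apply sumR_0.
        intros k hk. rewrite (dot_self_zero m v e k hk). ring.
      - assert (lam <= quad m A v / dot m v v).
        { apply hlub. intros l hl. specialize (hl v).
          apply Rmult_le_reg_r with (dot m v v); [lra|].
          unfold Rdiv. rewrite Rmult_assoc, Rinv_l, Rmult_1_r by lra. exact hl. }
        apply Rmult_le_compat_r with (r := dot m v v) in H0; [|lra].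
        unfold Rdiv in H0. rewrite Rmult_assoc, Rinv_l, Rmult_1_r in H0 by lra. exact H0. }
    exists lam. split; [|exact hlam].
    set (B := fun a b => A a b - if Nat.eq_dec a b then lam else 0).
    assert (EB : forall v a, (a < m)%nat -> matvec m B v a = matvec m A v a - lam * v a).
    { intros v a ha. unfold matvec, B.
      rewrite (sumR_ext m _ (fun b => A a b * v b - (if Nat.eq_dec a b then lam * v a else 0))).
      - rewrite sumR_minus. f_equal. clear -ha.
        induction m as [|m IH]; [lia|]. simpl.
        destruct (Nat.eq_dec a m) as [->|ne].
        + rewrite sumR_0; [ring|]. intros k hk. destruct (Nat.eq_dec m k); [lia|auto].
        + rewrite IH by lia. ring.
      - intros b _. destruct (Nat.eq_dec a b); [subst|]; ring. }
    assert (EQ : forall v, quad m B v = quad m A v - lam * dot m v v).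
    { intros v. unfold quad, dot. rewrite <- sumR_scal, <- sumR_minus.
      apply sumR_ext. intros k hk. rewrite EB by auto. ring. }
    assert (hB : symmetric m B).
    { intros a b ha hb'. unfold B. rewrite (hA a b) by auto.
      destruct (Nat.eq_dec a b), (Nat.eq_dec b a); congruence. }
    assert (hpB : forall v, 0 <= quad m B v) by (intros v; rewrite EQ; specialize (hlam v); lra).
    destruct (psd_null_or_coercive m B hB hpB) as [[v [[a [ha hv]] e]]|[eps [heps h]]].
    + exists (trunc m v). split; [apply trunc_in_Rn|]. split.
      * exists a. split; [auto|]. rewrite trunc_eq; auto.
      * intros b hb'. rewrite trunc_eq by auto.
        rewrite (matvec_ext m A _ v) by (intros; apply trunc_eq; auto).
        pose proof (psd_null_vector m B v hB hpB e b hb') as h. rewrite EB in h by auto. lra.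
    + exfalso. assert (lam + eps <= lam); [|lra]. apply hub. intros v.
      specialize (h v). rewrite EQ in h. lra.
Qed.

Lemma quad_symp m A v : quad m (symp A) v = quad m A v.
Proof.
  assert (E : sumR m (fun a => sumR m (fun b => v a * (A a b * v b)))
            = sumR m (fun a => sumR m (fun b => v a * (A b a * v b)))).
  { rewrite sumR_swap. apply sumR_ext; intros; apply sumR_ext; intros; ring. }
  unfold quad, dot, matvec, symp.
  rewrite (sumR_ext m _ (fun a => / 2 * (sumR m (fun b => v a * (A a b * v b))
     + sumR m (fun b => v a * (A b a * v b))))).
  - rewrite sumR_scal, sumR_plus, <- E.
    rewrite (sumR_ext m (fun a => v a * _) (fun a => sumR m (fun b => v a * (A a b * v b))))
      by (intros; rewrite sumR_scal; reflexivity).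
    field.
  - intros a _. rewrite <- sumR_plus, <- !sumR_scal. apply sumR_ext; intros; field.
Qed.

(** [alpha i] is an infimum over numbers satisfying [is_lambda_least], so one must exist at every
    profile before that infimum bounds the quadratic form there. *)
Lemma is_lambda_least_exists m A : (0 < m)%nat ->
  exists lam, is_lambda_least m A lam /\ forall v, lam * dot m v v <= quad m A v.
Proof.
  intros hm.
  destruct (least_eigenvalue_Rayleigh m (symp A) hm) as [lam [he h]].
  { intros a b _ _. unfold symp. f_equal; ring. }
  exists lam. split.
  - split; [exact he|]. intros mu [v [_ [[a [ha hv]] e]]].
    specialize (h v).
    assert (E : quad m (symp A) v = mu * dot m v v).
    { unfold quad, dot. rewrite <- sumR_scal. apply sumR_ext. intros k hk. rewrite e by auto. ring. }
    rewrite E in h. apply Rmult_le_reg_r with (dot m v v); [|exact h].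
    pose proof (dot_self_nonneg m v).
    destruct (Req_dec (dot m v v) 0) as [e0|]; [|lra].
    exfalso. apply hv. apply (dot_self_zero m v e0 a ha).
  - intros v. rewrite <- quad_symp. apply h.
Qed.

(** * M-matrices *)

Lemma det_ext m A B : (forall a b, (a < m)%nat -> (b < m)%nat -> A a b = B a b) -> det m A = det m B.
Proof.
  revert A B. induction m as [|m IH]; intros A B h; [reflexivity|].
  cbn [det]. apply sumR_ext. intros j hj. rewrite h by lia. f_equal.
  apply IH. intros a b ha hb. apply h; [lia|]. destruct (b <? j)%nat; lia.
Qed.

Lemma Sorted_map_S s : Sorted lt s -> Sorted lt (map S s).
Proof.
  induction 1 as [|a s hs IH hd]; simpl; constructor; auto.
  destruct hd; simpl; constructor; lia.
Qed.

Lemma Pmatrix_corner_pos m A : Pmatrix (S m) A -> A 0%nat 0%nat > 0.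
Proof.
  intros h. specialize (h (0%nat :: nil)).
  assert (H : det 1 (fun a b => A (nth a (0%nat :: nil) 0%nat) (nth b (0%nat :: nil) 0%nat)) > 0).
  { apply h; [discriminate|repeat constructor|]. intros a [<-|[]]; lia. }
  simpl in H. lra.
Qed.

(** The principal minor of [A] on the indices [0 :: map S s] factors as the corner entry times the
    minor of the Schur complement on [s]. *)
Lemma Pmatrix_schur m A : Pmatrix (S m) A -> Pmatrix m (schur A).
Proof.
  intros hP s hs hsort hlt. pose proof (Pmatrix_corner_pos m A hP) as h0.
  assert (h : det (S (length s)) (fun a b => A (nth a (0%nat :: map S s) 0%nat)
     (nth b (0%nat :: map S s) 0%nat)) > 0).
  { rewrite <- (length_map S s). apply (hP (0%nat :: map S s)); [discriminate| |].
    - constructor; [apply Sorted_map_S; auto|]. destruct s; constructor; lia.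
    - intros a [<-|ha]; [lia|]. apply in_map_iff in ha. destruct ha as [b [<- hb]].
      specialize (hlt b hb). lia. }
  rewrite det_schur in h by (simpl; lra).
  cbn [nth] in h.
  erewrite det_ext in h.
  - apply Rmult_lt_reg_l with (A 0%nat 0%nat); [exact h0|]. rewrite Rmult_0_r. exact h.
  - intros a b ha hb. unfold schur.
    (* [map_nth] wants the default to be the image S 0 = 1 of the default of [s], so it is changed
       from 0 first; all positions are in range. *)
    rewrite !(nth_indep (map S s) 0%nat 1%nat) by (rewrite length_map; lia).
    rewrite !(map_nth S s 0%nat). reflexivity.
Qed.

Lemma finite_common_bound (m : nat) (P : nat -> R -> Prop) :
  (forall k e e', (k < m)%nat -> P k e -> 0 < e' <= e -> P k e') ->
  (forall k, (k < m)%nat -> exists e, e > 0 /\ P k e) ->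
  exists e, e > 0 /\ forall k, (k < m)%nat -> P k e.
Proof.
  induction m as [|m IH]; intros hmon h.
  - exists 1. split; [lra|]. intros; lia.
  - destruct IH as [e [he hP]].
    + intros k e e' hk. apply hmon; lia.
    + intros k hk. apply h; lia.
    + destruct (h m) as [e' [he' hP']]; [lia|].
      exists (Rmin e e'). assert (hm : Rmin e e' > 0) by (apply Rmin_pos; lra).
      split; [exact hm|]. intros k hk. destruct (Nat.eq_dec k m) as [->|].
      * apply (hmon _ e'); auto. split; [lra|apply Rmin_r].
      * apply (hmon _ e); [auto|apply hP; lia|]. split; [lra|apply Rmin_l].
Qed.

(* Schur complements of Z-matrices are Z-matrices; back substitution lifts the positive vector,
   with a small extra weight on the eliminated coordinate making its row strictly positive. *)
Lemma P_Zmatrix_positive_vector m A : Pmatrix m A ->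
  (forall i j, (i < m)%nat -> (j < m)%nat -> i <> j -> A i j <= 0) ->
  exists w, (forall i, (i < m)%nat -> 0 < w i) /\
            (forall i, (i < m)%nat -> 0 < matvec m A w i).
Proof.
  revert A. induction m as [|m IH]; intros A hP hZ.
  - exists (fun _ => 0). split; intros; lia.
  - pose proof (Pmatrix_corner_pos m A hP) as h0.
    pose proof (Rinv_0_lt_compat _ h0) as hi.
    destruct (IH (schur A) (Pmatrix_schur m A hP)) as [w [hw hA]].
    + intros i j hi' hj ne. unfold schur.
      assert (A (S i) (S j) <= 0) by (apply hZ; lia).
      assert (A (S i) 0%nat <= 0) by (apply hZ; lia).
      assert (A 0%nat (S j) <= 0) by (apply hZ; lia).
      assert (0 <= A (S i) 0%nat * A 0%nat (S j)) by nra.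
      assert (0 <= A (S i) 0%nat * A 0%nat (S j) / A 0%nat 0%nat) by (apply Rmult_le_pos; lra). lra.
    + destruct (finite_common_bound m (fun i e => 0 < matvec m (schur A) w i + A (S i) 0%nat * e))
        as [e [he h]].
      * intros k e e' hk h he.
        assert (A (S k) 0%nat <= 0) by (apply hZ; lia). nra.
      * intros k hk. specialize (hA k hk).
        assert (ha : A (S k) 0%nat <= 0) by (apply hZ; lia).
        set (p := matvec m (schur A) w k) in *. set (a := A (S k) 0%nat) in *.
        (* This value solves p + a e = e, so the quantity to be kept positive equals [e] itself. *)
        exists (p / (1 - a)). split; [apply Rdiv_lt_0_compat; lra|].
        replace (p + a * (p / (1 - a))) with (p / (1 - a)) by (field; lra).
        apply Rdiv_lt_0_compat; lra.
      * set (d := sumR m (fun j => A 0%nat (S j) * w j)).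
        assert (hd : d <= 0).
        { rewrite <- (sumR_0 m (fun _ => 0)) by auto. apply sumR_le. intros j hj.
          assert (A 0%nat (S j) <= 0) by (apply hZ; lia). specialize (hw j hj). nra. }
        exists (fun k => match k with O => - d / A 0%nat 0%nat + e | S k => w k end).
        split.
        -- intros [|i] hi'; [|apply hw; lia].
           assert (0 <= - d / A 0%nat 0%nat) by (apply Rmult_le_pos; lra). lra.
        -- intros i hi'. unfold matvec. rewrite sumR_S_first.
           destruct i as [|i].
           ++ fold d. replace (_ + d) with (A 0%nat 0%nat * e) by (field; lra). nra.
           ++ specialize (h i ltac:(lia)). unfold matvec, schur in h.
              rewrite (sumR_ext m _ (fun b => A (S i) (S b) * w b
                 - (A (S i) 0%nat / A 0%nat 0%nat) * (A 0%nat (S b) * w b))) in h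
                by (intros; field; lra).
              rewrite sumR_minus, sumR_scal in h. fold d in h.
              replace (_ + _) with (sumR m (fun b => A (S i) (S b) * w b)
                - A (S i) 0%nat / A 0%nat 0%nat * d + A (S i) 0%nat * e) by (field; lra).
              exact h.
Qed.

(** * Derivatives along lines *)

Lemma pdist_small I n d : d > 0 ->
  exists r, r > 0 /\ forall x y, (forall j l, Rabs (x j l - y j l) < r) -> pdist I n x y < d.
Proof.
  intros hd. set (M := sumR I (fun i => INR (n i))).
  assert (hM : 0 <= M) by (apply sumR_nonneg; intros; apply pos_INR).
  exists (d / (M + 1)). assert (hr : d / (M + 1) > 0) by (apply Rdiv_lt_0_compat; lra).
  split; [exact hr|]. set (r := d / (M + 1)) in *. intros x y h.
  assert (E : r * (M + 1) = d) by (unfold r; field; lra).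
  assert (hle : pdist I n x y <= sqrt (M * (r * r))).
  { apply sqrt_le_1_alt. unfold M. rewrite <- sumR_scal_r. apply sumR_le. intros i _.
    rewrite <- sumR_const. apply sumR_le. intros k _. specialize (h i k).
    apply Rabs_def2 in h. nra. }
  apply Rle_lt_trans with (1 := hle). rewrite <- (sqrt_square d) by lra.
  apply sqrt_lt_1_alt. rewrite <- E. split; [nra|].
  assert (0 < r * r) by nra. nra.
Qed.

(** Increments [t * d j l] of either sign, or zero, occur below, whereas [MVT_cor2] wants an ordered
    interval; hence the hypothesis symmetric in the sign of [b]. *)
Lemma mean_value_signed G G' b :
  (forall c, Rabs c <= Rabs b -> derivable_pt_lim G c (G' c)) ->
  exists c, Rabs c <= Rabs b /\ G b - G 0 = G' c * b.
Proof.
  intros h. destruct (Rtotal_order b 0) as [hb|[->|hb]].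
  - destruct (MVT_cor2 G G' b 0 hb) as [c [e hc]].
    + intros c hc. apply h. rewrite !Rabs_left1 by lra. lra.
    + exists c. rewrite !Rabs_left1 by lra. split; lra.
  - exists 0. split; [lra|ring].
  - destruct (MVT_cor2 G G' 0 b hb) as [c [e hc]].
    + intros c hc. apply h. rewrite !Rabs_pos_eq by lra. lra.
    + exists c. rewrite !Rabs_pos_eq by lra. split; lra.
Qed.

Lemma upd_same x i v : upd x i v i = v.
Proof. unfold upd. destruct (Nat.eq_dec i i); [reflexivity|lia]. Qed.

Lemma upd_other x i v j : j <> i -> upd x i v j = x j.
Proof. intros h. unfold upd. destruct (Nat.eq_dec j i); [lia|reflexivity]. Qed.

Lemma upd_id x i : upd x i (x i) = x.
Proof.
  apply functional_extensionality. intros j. unfold upd. destruct (Nat.eq_dec j i); subst; reflexivity.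
Qed.

Lemma pshift_at x j l t : pshift x j l t j l = x j l + t.
Proof. unfold pshift. rewrite upd_same. destruct (Nat.eq_dec l l); [reflexivity|lia]. Qed.

Lemma pshift_off x j l t a b : (a, b) <> (j, l) -> pshift x j l t a b = x a b.
Proof.
  intros h. unfold pshift, upd. destruct (Nat.eq_dec a j) as [->|]; [|reflexivity].
  destruct (Nat.eq_dec b l) as [->|]; [congruence|reflexivity].
Qed.

Lemma prof_ext (x y : prof) : (forall i k, x i k = y i k) -> x = y.
Proof.
  intros h. apply functional_extensionality; intros i. apply functional_extensionality; apply h.
Qed.

Lemma pshift_pshift x j l s t : pshift (pshift x j l s) j l t = pshift x j l (s + t).
Proof.
  apply prof_ext. intros a b. destruct (classic ((a, b) = (j, l))) as [[= -> ->]|ne].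
  - rewrite !pshift_at. ring.
  - rewrite !pshift_off; auto.
Qed.

Lemma pshift_0 x j l : pshift x j l 0 = x.
Proof.
  apply prof_ext. intros a b. destruct (classic ((a, b) = (j, l))) as [[= -> ->]|ne].
  - rewrite pshift_at. ring.
  - rewrite pshift_off; auto.
Qed.

Lemma pshift_in_E I n x j l t : vidx I n j l -> in_E I n x -> in_E I n (pshift x j l t).
Proof.
  intros [hj hl] hx i. split.
  - intros hi k hk. rewrite pshift_off; [apply (proj1 (hx i)); auto|intros e; injection e; intros; subst; lia].
  - intros hi k. rewrite pshift_off; [apply (proj2 (hx i)); auto|intros e; injection e; intros; subst; lia].
Qed.

Lemma is_partial_shift g x j l s d :
  is_partial g (pshift x j l s) j l d -> derivable_pt_lim (fun t => g (pshift x j l t)) s d.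
Proof.
  intros h eps heps. destruct (h eps heps) as [dl hd]. exists dl. intros k hk hkd.
  specialize (hd k hk hkd). rewrite Rplus_0_l, !pshift_pshift, Rplus_0_r in hd. exact hd.
Qed.

(** Only partial derivatives are given, so the displacement t d is carried out one coordinate at a
    time, the tail of the list before its head. *)
Fixpoint coord_path (L : list (nat * nat)) (x d : prof) (t : R) : prof :=
  match L with
  | nil => x
  | (j, l) :: L' => pshift (coord_path L' x d t) j l (t * d j l)
  end.

Fixpoint list_sum (L : list (nat * nat)) (h : nat -> nat -> R) : R :=
  match L with nil => 0 | (j, l) :: L' => h j l + list_sum L' h end.

Lemma list_sum_nonneg L h : (forall j l, 0 <= h j l) -> 0 <= list_sum L h.
Proof. intros hh. induction L as [|[j l] L IH]; simpl; [lra|]. specialize (hh j l). lra. Qed.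

Lemma coord_path_dist L x d t a b :
  Rabs (coord_path L x d t a b - x a b) <= Rabs t * list_sum L (fun j l => Rabs (d j l)).
Proof.
  induction L as [|[j l] L IH]; simpl.
  - unfold Rminus. rewrite Rplus_opp_r, Rabs_R0. lra.
  - destruct (classic ((a, b) = (j, l))) as [[= -> ->]|ne].
    + rewrite pshift_at.
      replace (_ + _ - _) with ((coord_path L x d t j l - x j l) + t * d j l) by ring.
      pose proof (Rabs_triang (coord_path L x d t j l - x j l) (t * d j l)).
      rewrite Rabs_mult in H. lra.
    + rewrite pshift_off by auto. pose proof (Rabs_pos t). pose proof (Rabs_pos (d j l)). nra.
Qed.

Lemma coord_path_in_E I n L x d t : Forall (fun c => vidx I n (fst c) (snd c)) L ->
  in_E I n x -> in_E I n (coord_path L x d t).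
Proof.
  intros hL hx. induction hL as [|[j l] L hc hL IH]; simpl; [exact hx|].
  apply pshift_in_E; auto.
Qed.

(** The classical argument that continuous partials imply differentiability: each coordinate move is
    evaluated by the mean value theorem, and continuity at [x] replaces the intermediate partial by
    the one at [x]. Half of [eps] goes to the moves already made, half to the new one. *)
Lemma C1_along_coord_path I n U g D L x d :
  open_E I n U -> (forall x, U x -> in_E I n x) -> C1_with I n U g D ->
  Forall (fun c => vidx I n (fst c) (snd c)) L -> U x ->
  forall eps, eps > 0 -> exists dl, dl > 0 /\ forall t, Rabs t < dl ->
    Rabs (g (coord_path L x d t) - g x - t * list_sum L (fun j l => D j l x * d j l))
      <= eps * Rabs t.
Proof.
  intros hU hUE hg hL hx. assert (hxE := hUE x hx).
  induction hL as [|[j l] L hc hL IH]; intros eps heps.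
  - exists 1. split; [lra|]. intros t _. simpl.
    replace (g x - g x - t * 0) with 0 by ring. rewrite Rabs_R0. pose proof (Rabs_pos t). nra.
  - simpl in hc. destruct (IH (eps / 2)) as [d1 [hd1 h1]]; [lra|].
    destruct (hg j l hc) as [hpart hcont].
    destruct (hU x hx) as [d2 [hd2 h2]].
    (* Chosen so that e |d j l| <= eps / 2; the added 1 covers d j l = 0. *)
    set (e := eps / (2 * (Rabs (d j l) + 1))).
    pose proof (Rabs_pos (d j l)) as hdp.
    assert (he : e > 0) by (apply Rdiv_lt_0_compat; lra).
    destruct (hcont x hx e he) as [d3 [hd3 h3]].
    destruct (pdist_small I n (Rmin d2 d3)) as [r [hr hrd]]; [apply Rmin_pos; lra|].
    set (S := list_sum L (fun j l => Rabs (d j l))).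
    assert (hS : 0 <= S) by (apply list_sum_nonneg; intros; apply Rabs_pos).
    exists (Rmin d1 (r / (S + Rabs (d j l) + 1))).
    assert (hq : 0 < r / (S + Rabs (d j l) + 1)) by (apply Rdiv_lt_0_compat; lra).
    split; [apply Rmin_pos; lra|]. intros t ht.
    assert (ht1 : Rabs t < d1) by (eapply Rlt_le_trans; [exact ht|apply Rmin_l]).
    assert (ht2 : Rabs t * (S + Rabs (d j l) + 1) < r).
    { apply Rmult_lt_reg_r with (/ (S + Rabs (d j l) + 1)); [apply Rinv_0_lt_compat; lra|].
      rewrite Rmult_assoc, Rinv_r, Rmult_1_r by lra.
      eapply Rlt_le_trans; [exact ht|apply Rmin_r]. }
    specialize (h1 t ht1). set (y := coord_path L x d t) in *.
    (* The intermediate profiles lie on a broken path that may leave both the segment and Q;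
       openness of [U] keeps them where the partials exist. *)
    assert (hz : forall s, Rabs s <= Rabs (t * d j l) ->
       U (pshift y j l s) /\ Rabs (D j l (pshift y j l s) - D j l x) < e).
    { intros s hs.
      assert (hdist : pdist I n x (pshift y j l s) < Rmin d2 d3).
      { apply hrd. intros a b. rewrite Rabs_minus_sym.
        pose proof (coord_path_dist L x d t a b) as hy. fold S in hy. fold y in hy.
        rewrite Rabs_mult in hs. pose proof (Rabs_pos t) as htp.
        destruct (classic ((a, b) = (j, l))) as [[= -> ->]|ne].
        - rewrite pshift_at. replace (_ + _ - _) with ((y j l - x j l) + s) by ring.
          pose proof (Rabs_triang (y j l - x j l) s). nra.
        - rewrite pshift_off by auto. nra. }
      assert (hin : U (pshift y j l s)).
      { apply h2; [apply pshift_in_E; auto; apply coord_path_in_E; auto|].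
        eapply Rlt_le_trans; [exact hdist|apply Rmin_l]. }
      split; [exact hin|]. apply h3; [exact hin|].
      eapply Rlt_le_trans; [exact hdist|apply Rmin_r]. }
    destruct (mean_value_signed (fun s => g (pshift y j l s))
                (fun s => D j l (pshift y j l s)) (t * d j l)) as [c [hc1 hc2]].
    { intros c hc'. apply is_partial_shift, hpart, hz, hc'. }
    destruct (hz c hc1) as [_ hc3].
    cbn [coord_path list_sum]. fold y. rewrite pshift_0 in hc2.
    set (W := list_sum L (fun j l => D j l x * d j l)) in *.
    replace (g (pshift y j l (t * d j l)) - g x - t * (D j l x * d j l + W))
      with ((g y - g x - t * W) + (D j l (pshift y j l c) - D j l x) * (t * d j l)) by lra.
    eapply Rle_trans; [apply Rabs_triang|].
    rewrite Rabs_mult, (Rabs_mult t).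
    assert (hee : e * (Rabs (d j l) + 1) = eps / 2) by (unfold e; field; lra).
    pose proof (Rabs_pos t) as htp.
    assert (Rabs (D j l (pshift y j l c) - D j l x) * (Rabs t * Rabs (d j l))
       <= e * (Rabs t * Rabs (d j l))) by (apply Rmult_le_compat_r; nra).
    nra.
Qed.

Fixpoint coords (I : nat) (n : nat -> nat) : list (nat * nat) :=
  match I with O => nil | S p => coords p n ++ map (pair p) (seq 0 (n p)) end.

Lemma in_coords I n j l : In (j, l) (coords I n) <-> vidx I n j l.
Proof.
  unfold vidx. induction I as [|I IH]; simpl; [lia|].
  rewrite in_app_iff, IH, in_map_iff. split.
  - intros [h|[k [[= -> ->] h]]]; [lia|]. apply in_seq in h. lia.
  - intros [h1 h2]. destruct (Nat.eq_dec j I) as [->|].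
    + right. exists l. split; [reflexivity|]. apply in_seq. lia.
    + left. lia.
Qed.

Lemma coords_NoDup I n : NoDup (coords I n).
Proof.
  induction I as [|I IH]; simpl; [constructor|]. apply NoDup_app; auto.
  - apply Injective_map_NoDup; [intros a b [= ->]; reflexivity|apply seq_NoDup].
  - intros [j l] h h'. apply in_coords in h. apply in_map_iff in h'.
    destruct h' as [k [[= -> ->] _]]. destruct h; lia.
Qed.

Lemma coords_valid I n : Forall (fun c => vidx I n (fst c) (snd c)) (coords I n).
Proof. apply Forall_forall. intros [j l] h. apply in_coords; exact h. Qed.

Lemma list_sum_app L1 L2 h : list_sum (L1 ++ L2) h = list_sum L1 h + list_sum L2 h.
Proof. induction L1 as [|[j l] L IH]; simpl; [ring|]. rewrite IH; ring. Qed.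

Lemma list_sum_coords I n h :
  list_sum (coords I n) h = sumR I (fun j => sumR (n j) (fun l => h j l)).
Proof.
  induction I as [|I IH]; [reflexivity|]. cbn [coords sumR]. rewrite list_sum_app, IH. f_equal.
  induction (n I) as [|m IHm]; [reflexivity|].
  rewrite seq_S, map_app, list_sum_app, IHm. simpl. ring.
Qed.

Definition line (x d : prof) (t : R) : prof := fun j k => x j k + t * d j k.

Definition index_eq_dec (c c' : nat * nat) : {c = c'} + {c <> c'}.
Proof. decide equality; apply Nat.eq_dec. Defined.

Lemma coord_path_value L x d t a b : NoDup L ->
  coord_path L x d t a b = if in_dec index_eq_dec (a, b) L
                           then x a b + t * d a b else x a b.
Proof.
  intros hL. induction hL as [|[j l] L hn hL IH]; [reflexivity|].
  cbn [coord_path]. destruct (in_dec _ (a, b) ((j, l) :: L)) as [h|h].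
  - destruct h as [[= -> ->]|h].
    + rewrite pshift_at, IH. destruct (in_dec _ (a, b) L); [tauto|reflexivity].
    + rewrite pshift_off by (intros e; rewrite e in h; tauto).
      rewrite IH. destruct (in_dec _ (a, b) L); [reflexivity|tauto].
  - rewrite pshift_off by (intros e; apply h; left; congruence).
    rewrite IH. destruct (in_dec _ (a, b) L); [|reflexivity].
    exfalso; apply h; right; auto.
Qed.

Lemma coord_path_coords I n x d t : in_E I n d -> coord_path (coords I n) x d t = line x d t.
Proof.
  intros hd. apply prof_ext. intros a b. rewrite coord_path_value by apply coords_NoDup.
  unfold line. destruct (in_dec _ (a, b) (coords I n)) as [h|h]; [reflexivity|].
  rewrite in_coords in h. unfold vidx in h.
  replace (d a b) with 0; [ring|]. symmetry.
  destruct (Nat.le_gt_cases I a); [apply (proj2 (hd a)); auto|apply (proj1 (hd a)); lia].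
Qed.

Definition grad_dot (I : nat) (n : nat -> nat) (D : nat -> nat -> prof -> R) (x d : prof) : R :=
  sumR I (fun j => sumR (n j) (fun l => D j l x * d j l)).

(** Rebasing at [line x d t0] reduces to small increments from that point. As [U] is open, the
    derivative is two-sided even where the line leaves Q, in particular at the ends of a segment. *)
Lemma derivable_along_line I n U g D x d t0 :
  open_E I n U -> (forall x, U x -> in_E I n x) -> C1_with I n U g D ->
  in_E I n d -> U (line x d t0) ->
  derivable_pt_lim (fun t => g (line x d t)) t0 (grad_dot I n D (line x d t0) d).
Proof.
  intros hU hUE hg hd hx eps heps.
  destruct (C1_along_coord_path I n U g D (coords I n) (line x d t0) d hU hUE hg
              (coords_valid I n) hx (eps / 2)) as [dl [hdl h]]; [lra|].
  exists (mkposreal dl hdl). intros s hs hsd. simpl in hsd. specialize (h s hsd).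
  rewrite coord_path_coords, list_sum_coords in h by auto.
  fold (grad_dot I n D (line x d t0) d) in h.
  replace (line (line x d t0) d s) with (line x d (t0 + s)) in h
    by (apply prof_ext; intros; unfold line; ring).
  set (W := grad_dot I n D (line x d t0) d) in *.
  replace ((g (line x d (t0 + s)) - g (line x d t0)) / s - W)
    with ((g (line x d (t0 + s)) - g (line x d t0) - s * W) / s) by (field; auto).
  unfold Rdiv. rewrite Rabs_mult, Rabs_inv.
  assert (hsp : 0 < Rabs s) by (apply Rabs_pos_lt; auto).
  apply Rle_lt_trans with (eps / 2 * Rabs s * / Rabs s).
  - apply Rmult_le_compat_r; [left; apply Rinv_0_lt_compat; auto|exact h].
  - rewrite Rmult_assoc, Rinv_r by lra. lra.
Qed.

(** * Selected terms of sums, one-sided minima, limits *)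

Lemma sumR_single m i h : (i < m)%nat -> (forall j, j <> i -> h j = 0) -> sumR m h = h i.
Proof.
  intros hi hz. induction m as [|m IH]; [lia|]. simpl.
  destruct (Nat.eq_dec i m) as [->|ne].
  - rewrite sumR_0; [ring|]. intros; apply hz; lia.
  - rewrite IH, (hz m) by lia. ring.
Qed.

Lemma sumR_split_at m i h : (i < m)%nat ->
  sumR m h = h i + sumR m (fun j => if Nat.eq_dec i j then 0 else h j).
Proof.
  intros hi.
  rewrite (sumR_ext m h (fun j => (if Nat.eq_dec i j then h i else 0)
                                  + (if Nat.eq_dec i j then 0 else h j))).
  - rewrite sumR_plus. f_equal.
    rewrite (sumR_single m i); [destruct (Nat.eq_dec i i); [reflexivity|lia]|exact hi|].
    intros j hj. destruct (Nat.eq_dec i j); [lia|reflexivity].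
  - intros j _. destruct (Nat.eq_dec i j); [subst|]; ring.
Qed.

Lemma derivable_sumR m (F : nat -> R -> R) (F' : nat -> R) t :
  (forall k, (k < m)%nat -> derivable_pt_lim (F k) t (F' k)) ->
  derivable_pt_lim (fun s => sumR m (fun k => F k s)) t (sumR m F').
Proof.
  induction m as [|m IH]; intros h; simpl.
  - apply derivable_pt_lim_const.
  - apply (derivable_pt_lim_plus (fun s => sumR m (fun k => F k s)) (F m)).
    + apply IH. intros; apply h; lia.
    + apply h; lia.
Qed.

Lemma derivative_nonneg_at_left_min phi d :
  derivable_pt_lim phi 0 d -> (forall t, 0 <= t <= 1 -> phi 0 <= phi t) -> 0 <= d.
Proof.
  intros hd hmin. destruct (Rle_lt_dec 0 d) as [|hneg]; [auto|exfalso].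
  destruct (hd (- d)) as [[dl hdl] h]; [lra|]. simpl in h.
  set (s := Rmin (dl / 2) 1). assert (hs : 0 < s) by (apply Rmin_pos; lra).
  assert (s <= dl / 2) by apply Rmin_l. assert (s <= 1) by apply Rmin_r.
  specialize (h s). rewrite Rplus_0_l in h.
  assert (hh : Rabs ((phi s - phi 0) / s - d) < - d).
  { apply h; [lra|]. rewrite Rabs_pos_eq; lra. }
  apply Rabs_def2 in hh.
  assert (0 <= (phi s - phi 0) / s).
  { apply Rmult_le_pos; [|left; apply Rinv_0_lt_compat; auto].
    specialize (hmin s). lra. }
  lra.
Qed.

Lemma finite_common_index (m : nat) (P : nat -> nat -> Prop) :
  (forall k N N', P k N -> (N <= N')%nat -> P k N') ->
  (forall k, (k < m)%nat -> exists N, P k N) ->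
  exists N, forall k, (k < m)%nat -> P k N.
Proof.
  intros hmon. induction m as [|m IH]; intros h.
  - exists 0%nat. intros; lia.
  - destruct IH as [N hN]; [intros; apply h; lia|].
    destruct (h m) as [N' hN']; [lia|].
    exists (Nat.max N N'). intros k hk. destruct (Nat.eq_dec k m) as [->|].
    + apply (hmon _ N'); [auto|lia].
    + apply (hmon _ N); [apply hN|]; lia.
Qed.

Lemma finite_upper_bound (m : nat) (g : nat -> R) :
  exists B, 0 <= B /\ forall k, (k < m)%nat -> g k <= B.
Proof.
  exists (sumR m (fun k => Rabs (g k))). split.
  - apply sumR_nonneg; intros; apply Rabs_pos.
  - intros k hk. eapply Rle_trans; [apply Rle_abs|].
    apply (sumR_term_le m (fun k => Rabs (g k))); [intros; apply Rabs_pos|auto].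
Qed.

Lemma closed_Cauchy_limit m (S : vec -> Prop) (u : nat -> vec) :
  closed_in m S -> (forall p, S (u p)) ->
  (forall k, (k < m)%nat -> Cauchy_crit (fun p => u p k)) ->
  exists v, in_Rn m v /\ S v /\
    forall eps, eps > 0 -> exists N, forall p, (N <= p)%nat ->
      forall k, (k < m)%nat -> Rabs (u p k - v k) <= eps.
Proof.
  intros hS hu hC.
  destruct (choice (fun k l => (k < m)%nat -> Un_cv (fun p => u p k) l)) as [v hv].
  { intros k. destruct (Nat.lt_ge_cases k m) as [hk|hk].
    - destruct (R_complete _ (hC k hk)) as [l hl]. exists l; auto.
    - exists 0. lia. }
  assert (hlim : forall eps, eps > 0 -> exists N, forall p, (N <= p)%nat ->
      forall k, (k < m)%nat -> Rabs (u p k - trunc m v k) <= eps).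
  { intros eps heps.
    destruct (finite_common_index m (fun k N => forall p, (N <= p)%nat ->
                Rabs (u p k - v k) <= eps)) as [N hN].
    - intros k N N' h hN p hp. apply h; lia.
    - intros k hk. destruct (hv k hk eps heps) as [N hN]. exists N. intros p hp.
      left. apply hN. lia.
    - exists N. intros p hp k hk. rewrite trunc_eq by auto. apply hN; auto. }
  (* The coordinatewise limit is unconstrained beyond [m], while [closed_in] accepts only
     zero-padded limits. *)
  exists (trunc m v). split; [apply trunc_in_Rn|]. split; [|exact hlim].
  apply (hS u); [exact hu|apply trunc_in_Rn|]. intros eps heps.
  pose proof (pos_INR m) as hm.
  destruct (hlim (eps / (INR m + 1))) as [N hN]; [apply Rdiv_lt_0_compat; lra|].
  exists N. intros p hp.
  apply Rle_lt_trans with (INR m * (eps / (INR m + 1))).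
  - apply norm2_le_coord; [left; apply Rdiv_lt_0_compat; lra|]. intros k hk. apply hN; auto.
  - apply Rmult_lt_reg_r with (INR m + 1); [lra|].
    replace (INR m * (eps / (INR m + 1)) * (INR m + 1)) with (INR m * eps) by (field; lra). nra.
Qed.

Lemma le_0_of_geometric a c r : 0 <= r < 1 -> (forall k, a <= c * r ^ k) -> a <= 0.
Proof.
  intros hr h. apply Rnot_lt_le. intros ha.
  assert (hc : 0 < c) by (specialize (h 0%nat); simpl in h; lra).
  destruct (pow_lt_1_zero r) with (y := a / c) as [N hN].
  - rewrite Rabs_pos_eq; lra.
  - apply Rdiv_lt_0_compat; lra.
  - specialize (hN N (le_n N)). specialize (h N).
    assert (c * r ^ N < c * (a / c)).
    { apply Rmult_lt_compat_l; [auto|]. eapply Rle_lt_trans; [apply Rle_abs|exact hN]. }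
    replace (c * (a / c)) with a in H by (field; lra). lra.
Qed.

(** * Jacobian blocks and contraction weights *)

Definition bilin (m p : nat) (B : nat -> nat -> R) (u v : vec) : R :=
  sumR m (fun k => sumR p (fun l => u k * B k l * v l)).

Lemma bilin_ext m p B u u' v v' :
  (forall k, (k < m)%nat -> u k = u' k) -> (forall k, (k < p)%nat -> v k = v' k) ->
  bilin m p B u v = bilin m p B u' v'.
Proof.
  intros hu hv. apply sumR_ext; intros k hk; apply sumR_ext; intros l hl. rewrite hu, hv; auto.
Qed.

(** The congruence C_i^T J C_j is moved onto the arguments. With z = C_i^-1 u and w = C_j^-1 v the
    right side is the unscaled block at u, v, so [alpha] and [beta] bound the Jacobian in the scaled
    norms. *)
Lemma dot_blk n C D2 i j x z w :
  dot (n i) z (matvec (n j) (blk n C D2 i j x) w) =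
  bilin (n i) (n j) (fun k l => D2 i i k j l x) (matvec (n i) (C i) z) (matvec (n j) (C j) w).
Proof.
  set (t := fun k => sumR (n j) (fun l => D2 i i k j l x * matvec (n j) (C j) w l)).
  transitivity (sumR (n i) (fun k => matvec (n i) (C i) z k * t k)).
  - unfold dot.
    rewrite (sumR_ext (n i) _ (fun a => sumR (n i) (fun k => C i k a * z a * t k))).
    + rewrite sumR_swap. apply sumR_ext. intros k _. rewrite sumR_scal_r. reflexivity.
    + intros a _. unfold matvec at 1, blk.
      rewrite (sumR_ext (n j) _ (fun b => sumR (n i) (fun k =>
        C i k a * sumR (n j) (fun l => D2 i i k j l x * C j l b * w b)))).
      * rewrite sumR_swap, <- sumR_scal. apply sumR_ext. intros k _.
        rewrite sumR_scal. unfold t.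
        replace (sumR (n j) (fun l => D2 i i k j l x * matvec (n j) (C j) w l))
          with (sumR (n j) (fun b => sumR (n j) (fun l => D2 i i k j l x * C j l b * w b))); [ring|].
        rewrite sumR_swap. apply sumR_ext. intros l _. unfold matvec.
        rewrite <- sumR_scal. apply sumR_ext; intros; ring.
      * intros b _. rewrite <- sumR_scal_r. apply sumR_ext. intros k _.
        rewrite <- sumR_scal, <- sumR_scal_r. apply sumR_ext; intros; ring.
  - apply sumR_ext. intros k _. unfold t. rewrite <- sumR_scal. apply sumR_ext; intros; ring.
Qed.

Lemma P_Zmatrix_contraction_weights I (alpha : nat -> R) (beta : nat -> nat -> R) :
  Pmatrix I (fun a b => if Nat.eq_dec a b then alpha a else - beta a b) ->
  (forall i j, (i < I)%nat -> (j < I)%nat -> i <> j -> 0 <= beta i j) ->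
  (forall i, (i < I)%nat -> 0 < alpha i) /\
  exists w rho, 0 <= rho < 1 /\ (forall i, (i < I)%nat -> 0 < w i) /\
    forall i, (i < I)%nat ->
      sumR I (fun j => if Nat.eq_dec i j then 0 else beta i j * w j) <= rho * (alpha i * w i).
Proof.
  intros hP hb.
  assert (ha : forall i, (i < I)%nat -> 0 < alpha i).
  { intros i hi. specialize (hP (i :: nil)).
    assert (h : det 1 (fun a b => if Nat.eq_dec (nth a (i :: nil) 0%nat) (nth b (i :: nil) 0%nat)
       then alpha (nth a (i :: nil) 0%nat)
       else - beta (nth a (i :: nil) 0%nat) (nth b (i :: nil) 0%nat)) > 0).
    { apply hP; [discriminate|repeat constructor|]. intros a [<-|[]]; auto. }
    simpl in h. destruct (Nat.eq_dec i i); [lra|lia]. }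
  split; [exact ha|].
  destruct (P_Zmatrix_positive_vector _ _ hP) as [w [hw hpos]].
  { intros i j hi hj ne. destruct (Nat.eq_dec i j); [lia|]. specialize (hb i j hi hj ne). lra. }
  set (S := fun i => sumR I (fun j => if Nat.eq_dec i j then 0 else beta i j * w j)).
  assert (hS : forall i, (i < I)%nat -> S i < alpha i * w i).
  { intros i hi. specialize (hpos i hi). unfold matvec in hpos.
    rewrite (sumR_split_at I i) in hpos by auto.
    destruct (Nat.eq_dec i i); [|lia].
    rewrite (sumR_ext I _ (fun j => -1 * (if Nat.eq_dec i j then 0 else beta i j * w j))) in hpos.
    - rewrite sumR_scal in hpos. fold (S i) in hpos. lra.
    - intros j _. destruct (Nat.eq_dec i j); ring. }
  destruct (finite_common_bound I (fun i e => S i <= (1 - e) * (alpha i * w i))) as [e [he h]].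
  - intros k e e' hk h1 h2. pose proof (Rmult_lt_0_compat _ _ (ha k hk) (hw k hk)). nra.
  - intros k hk. pose proof (Rmult_lt_0_compat _ _ (ha k hk) (hw k hk)) as hp.
    (* The relative slack of row k, for which the required inequality is an equality. *)
    specialize (hS k hk). exists ((alpha k * w k - S k) / (alpha k * w k)).
    split; [apply Rdiv_lt_0_compat; lra|]. right.
    set (p := alpha k * w k) in *. field. lra.
  (* The minimum with 1 keeps the rate nonnegative. *)
  - exists w, (1 - Rmin e 1). pose proof (Rmin_l e 1). pose proof (Rmin_r e 1).
    assert (0 < Rmin e 1) by (apply Rmin_pos; lra).
    split; [lra|]. split; [exact hw|]. intros i hi. specialize (h i hi).
    pose proof (Rmult_lt_0_compat _ _ (ha i hi) (hw i hi)). fold (S i). nra.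
Qed.

(** * Best responses and equilibria *)

Section Game.
Context (I : nat) (n : nat -> nat) (Q : nat -> vec -> Prop) (f : nat -> prof -> R)
  (U : prof -> Prop) (D1 : nat -> nat -> nat -> prof -> R)
  (D2 : nat -> nat -> nat -> nat -> nat -> prof -> R)
  (U_open : open_E I n U) (Q_sub_U : forall x, inQ I n Q x -> U x)
  (U_sub_E : forall x, U x -> in_E I n x)
  (f_C1 : forall i, (i < I)%nat -> C1_with I n U (f i) (D1 i))
  (D1_C1 : forall i j l, (i < I)%nat -> vidx I n j l -> C1_with I n U (D1 i j l) (D2 i j l))
  (Q_closed : forall i, (i < I)%nat -> closed_in (n i) (memQ n Q i))
  (Q_convex : forall i, (i < I)%nat -> convex_set (memQ n Q i))
  (Q_nonempty : forall i, (i < I)%nat -> exists v, memQ n Q i v).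

(* [Dm i] is the inverse of the scaling matrix C_i, so [q i] is the norm |C_i^-1 v|. *)
Context (Dm : nat -> nat -> nat -> R) (K L : nat -> R).
Definition q (i : nat) (v : vec) : R := norm2 (n i) (matvec (n i) (Dm i) v).

Context (q_coord : forall i v k, (i < I)%nat -> (k < n i)%nat -> Rabs (v k) <= K i * q i v)
  (q_upper : forall i v r, (i < I)%nat -> 0 <= r ->
     (forall k, (k < n i)%nat -> Rabs (v k) <= r) -> q i v <= L i * r).

(** These bounds concern the unscaled Jacobian, the matrices C_i being hidden in [q]. The
    off-diagonal one is one-sided because only a lower bound on the derivative of the slope enters
    the comparison. *)
Context (alpha : nat -> R) (beta : nat -> nat -> R) (w : nat -> R) (rho : R)
  (alpha_pos : forall i, (i < I)%nat -> 0 < alpha i)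
  (beta_nonneg : forall i j, (i < I)%nat -> (j < I)%nat -> i <> j -> 0 <= beta i j)
  (diag_bound : forall i x d, (i < I)%nat -> inQ I n Q x ->
     alpha i * (q i d * q i d) <= bilin (n i) (n i) (fun k l => D2 i i k i l x) d d)
  (offdiag_bound : forall i j x u v, (i < I)%nat -> (j < I)%nat -> i <> j -> inQ I n Q x ->
     - (beta i j * (q i u * q j v)) <= bilin (n i) (n j) (fun k l => D2 i i k j l x) u v)
  (rho_lt : 0 <= rho < 1) (w_pos : forall i, (i < I)%nat -> 0 < w i)
  (contraction : forall i, (i < I)%nat ->
     sumR I (fun j => if Nat.eq_dec i j then 0 else beta i j * w j) <= rho * (alpha i * w i)).

(** * The scaled norms *)

Lemma q_nonneg i v : 0 <= q i v.
Proof. apply norm2_nonneg. Qed.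

Lemma q_ext i u v : (forall k, (k < n i)%nat -> u k = v k) -> q i u = q i v.
Proof. intros h. apply norm2_ext. intros k _. apply matvec_ext; auto. Qed.

Lemma q_scal i c v : q i (fun k => c * v k) = Rabs c * q i v.
Proof.
  unfold q. rewrite <- norm2_scal. apply norm2_ext. intros k _. apply matvec_scal.
Qed.

Lemma q_sub_sym i u v : q i (fun k => u k - v k) = q i (fun k => v k - u k).
Proof.
  rewrite (q_ext i _ (fun k => -1 * (v k - u k))) by (intros; ring).
  rewrite (q_scal i (-1) (fun k => v k - u k)), Rabs_left by lra. ring.
Qed.

Lemma q_triang i u v z :
  q i (fun k => u k - z k) <= q i (fun k => u k - v k) + q i (fun k => v k - z k).
Proof.
  unfold q. eapply Rle_trans; [right|apply norm2_triang].
  apply norm2_ext. intros k _. cbn beta. rewrite !matvec_minus. ring.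
Qed.

Lemma q_self i v : q i (fun k => v k - v k) = 0.
Proof.
  rewrite (q_ext i _ (fun k => 0 * v k)) by (intros; ring).
  rewrite q_scal, Rabs_R0. ring.
Qed.

Lemma q_zero i u v : (i < I)%nat -> in_Rn (n i) u -> in_Rn (n i) v ->
  q i (fun k => u k - v k) <= 0 -> u = v.
Proof.
  intros hi hu hv h. apply functional_extensionality. intros k.
  destruct (Nat.lt_ge_cases k (n i)) as [hk|hk]; [|rewrite hu, hv; auto].
  pose proof (q_coord i (fun k => u k - v k) k hi hk) as hc. cbn beta in hc.
  pose proof (q_nonneg i (fun k => u k - v k)).
  replace (q i (fun k => u k - v k)) with 0 in hc by lra.
  pose proof (Rabs_pos (u k - v k)). apply Rminus_diag_uniq.
  destruct (Req_dec (u k - v k) 0) as [|ne]; auto. apply Rabs_pos_lt in ne. lra.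
Qed.

(** * Feasible profiles and the segments joining them *)

Lemma inQ_memQ x i : inQ I n Q x -> (i < I)%nat -> memQ n Q i (x i).
Proof. intros [hE hQ] hi. split; [apply (proj1 (hE i) hi)|auto]. Qed.

Lemma memQ_inQ x : (forall i, (i < I)%nat -> memQ n Q i (x i)) ->
  (forall i, (I <= i)%nat -> forall k, x i k = 0) -> inQ I n Q x.
Proof.
  intros h h0. split; [|intros i hi; apply h; auto].
  intros i; split; [intros hi; apply h; auto|apply h0].
Qed.

Lemma inQ_nonempty : exists x, inQ I n Q x.
Proof.
  destruct (choice (fun i u => ((i < I)%nat -> memQ n Q i u) /\
     ((I <= i)%nat -> forall k, u k = 0))) as [x0 hx0].
  { intros i. destruct (Nat.lt_ge_cases i I) as [hi|hi].
    - destruct (Q_nonempty i hi) as [u hu]. exists u. split; [auto|lia].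
    - exists (fun _ => 0). split; [lia|auto]. }
  exists x0. apply memQ_inQ; intros i; apply hx0.
Qed.

Lemma inQ_outside x i k : inQ I n Q x -> (I <= i)%nat -> x i k = 0.
Proof. intros [hE _] hi. apply (proj2 (hE i) hi). Qed.

Lemma inQ_upd x i v : inQ I n Q x -> (i < I)%nat -> memQ n Q i v -> inQ I n Q (upd x i v).
Proof.
  intros hx hi hv. apply memQ_inQ; intros j hj.
  - destruct (Nat.eq_dec j i) as [->|ne]; [rewrite upd_same; auto|].
    rewrite upd_other by auto. apply inQ_memQ; auto.
  - intros k. rewrite upd_other by lia. apply inQ_outside; auto.
Qed.

Definition psub (y x : prof) : prof := fun j k => y j k - x j k.

Lemma psub_in_E x y : inQ I n Q x -> inQ I n Q y -> in_E I n (psub y x).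
Proof.
  intros [hx _] [hy _] i. unfold psub. split; intros hi k; [intros hk|].
  - rewrite (proj1 (hx i) hi k hk), (proj1 (hy i) hi k hk). ring.
  - rewrite (proj2 (hx i) hi k), (proj2 (hy i) hi k). ring.
Qed.

Lemma line_psub_inQ x y t : inQ I n Q x -> inQ I n Q y -> 0 <= t <= 1 ->
  inQ I n Q (line x (psub y x) t).
Proof.
  intros hx hy ht. apply memQ_inQ; intros j hj.
  - replace (line x (psub y x) t j) with (fun k => t * y j k + (1 - t) * x j k).
    + apply Q_convex; auto; apply inQ_memQ; auto.
    + apply functional_extensionality; intros k; unfold line, psub; ring.
  - intros k. unfold line, psub. rewrite (inQ_outside x), (inQ_outside y) by auto. ring.
Qed.

Lemma line_0 x d : line x d 0 = x.
Proof. apply prof_ext; intros; unfold line; ring. Qed.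

Lemma line_psub_1 x y : line x (psub y x) 1 = y.
Proof. apply prof_ext; intros; unfold line, psub; ring. Qed.

(** The inner product of F_i(x) with a fixed direction: a scalar function of the profile, to which
    the mean value theorem applies. *)
Definition own_slope (i : nat) (x : prof) (d : vec) : R := dot (n i) (fun k => D1 i i k x) d.

Lemma own_slope_derivable i x y d t : (i < I)%nat -> inQ I n Q x -> inQ I n Q y -> 0 <= t <= 1 ->
  derivable_pt_lim (fun s => own_slope i (line x (psub y x) s) d) t
    (sumR I (fun j => bilin (n i) (n j) (fun k l => D2 i i k j l (line x (psub y x) t))
                        d (psub y x j))).
Proof.
  intros hi hx hy ht.
  set (X := line x (psub y x) t).
  replace (sumR I _) with
    (sumR (n i) (fun k => d k * grad_dot I n (D2 i i k) X (psub y x))).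
  - unfold own_slope, dot.
    replace (fun s => sumR (n i) (fun k => D1 i i k (line x (psub y x) s) * d k))
      with (fun s => sumR (n i) (fun k => d k * D1 i i k (line x (psub y x) s)))
      by (apply functional_extensionality; intros; apply sumR_ext; intros; ring).
    apply (derivable_sumR (n i) (fun k s => d k * D1 i i k (line x (psub y x) s))).
    intros k hk.
    apply (derivable_pt_lim_scal (fun s => D1 i i k (line x (psub y x) s)) (d k)).
    apply (derivable_along_line I n U (D1 i i k) (D2 i i k)); auto.
    + apply D1_C1; [auto|split; auto].
    + apply psub_in_E; auto.
    + apply Q_sub_U, line_psub_inQ; auto.
  - unfold bilin. rewrite <- sumR_swap. apply sumR_ext. intros k _.
    unfold grad_dot. rewrite <- sumR_scal. apply sumR_ext. intros j _.
    rewrite <- sumR_scal. apply sumR_ext; intros; ring.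
Qed.

Lemma payoff_derivable_own i x v t : (i < I)%nat -> inQ I n Q x -> memQ n Q i v -> 0 <= t <= 1 ->
  derivable_pt_lim (fun s => f i (line x (psub (upd x i v) x) s)) t
    (own_slope i (line x (psub (upd x i v) x) t) (fun k => v k - x i k)).
Proof.
  intros hi hx hv ht. set (y := upd x i v). assert (hy : inQ I n Q y) by (apply inQ_upd; auto).
  replace (own_slope i _ _) with (grad_dot I n (D1 i) (line x (psub y x) t) (psub y x)).
  - apply (derivable_along_line I n U); auto.
    + apply psub_in_E; auto.
    + apply Q_sub_U, line_psub_inQ; auto.
  - unfold grad_dot. rewrite (sumR_single I i); auto.
    + unfold own_slope, dot, psub, y. rewrite upd_same. reflexivity.
    + intros j hj. apply sumR_0. intros l _. unfold psub, y. rewrite upd_other by auto. ring.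
Qed.

Definition plays_best (i : nat) (x : prof) : Prop :=
  forall y, memQ n Q i y -> f i x <= f i (upd x i y).

Lemma line_upd x i v t : line x (psub (upd x i v) x) t = upd x i (fun k => t * v k + (1 - t) * x i k).
Proof.
  apply prof_ext. intros j k. unfold line, psub, upd. destruct (Nat.eq_dec j i); [subst|]; ring.
Qed.

(** The variational inequality of player [i]: by convexity of Q_i the segment towards [v] consists
    of admissible deviations, so its payoff is minimal at t = 0. *)
Lemma plays_best_slope i x v : (i < I)%nat -> inQ I n Q x -> plays_best i x -> memQ n Q i v ->
  0 <= own_slope i x (fun k => v k - x i k).
Proof.
  intros hi hx hb hv. rewrite <- (line_0 x (psub (upd x i v) x)) at 1.
  apply (derivative_nonneg_at_left_min (fun s => f i (line x (psub (upd x i v) x) s))).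
  - apply payoff_derivable_own; auto. lra.
  - intros t ht. rewrite line_0, line_upd. apply hb. apply Q_convex; auto. apply inQ_memQ; auto.
Qed.

Lemma best_response_comparison i x y : (i < I)%nat -> inQ I n Q x -> inQ I n Q y ->
  plays_best i x -> plays_best i y ->
  alpha i * q i (psub y x i) <=
    sumR I (fun j => if Nat.eq_dec i j then 0 else beta i j * q j (psub y x j)).
Proof.
  intros hi hx hy hbx hby. set (d := psub y x).
  set (S := sumR I (fun j => if Nat.eq_dec i j then 0 else beta i j * q j (d j))).
  assert (h0 : 0 <= own_slope i x (d i)) by (apply plays_best_slope; auto; apply inQ_memQ; auto).
  assert (h1 : own_slope i y (d i) <= 0).
  { pose proof (plays_best_slope i y (x i) hi hy hby (inQ_memQ x i hx hi)) as h.
    replace (own_slope i y (fun k => x i k - y i k)) with (-1 * own_slope i y (d i)) in h; [lra|].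
    unfold own_slope, dot. rewrite <- sumR_scal. apply sumR_ext; intros; unfold d, psub; ring. }
  (* Since the direction [d i] is frozen, one point [c] serves the blocks of all players j at once.
     The increment being evaluated is nonpositive by [h0] and [h1]. *)
  destruct (MVT_cor2 (fun s => own_slope i (line x d s) (d i)) (fun t =>
      sumR I (fun j => bilin (n i) (n j) (fun k l => D2 i i k j l (line x d t)) (d i) (d j))) 0 1)
    as [c [e hc]]; [lra| |].
  { intros c hc. apply own_slope_derivable; auto. }
  unfold d in e at 1 4. rewrite line_psub_1, line_0 in e. fold d in e.
  assert (hX : inQ I n Q (line x d c)) by (apply line_psub_inQ; auto; lra).
  rewrite (sumR_split_at I i) in e by auto.
  pose proof (diag_bound i _ (d i) hi hX) as hdiag.
  assert (hoff : - (q i (d i) * S) <= sumR I (fun j => if Nat.eq_dec i j then 0 else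
     bilin (n i) (n j) (fun k l => D2 i i k j l (line x d c)) (d i) (d j))).
  { replace (- (q i (d i) * S)) with (- q i (d i) * S) by ring. unfold S.
    rewrite <- sumR_scal. apply sumR_le. intros j hj.
    destruct (Nat.eq_dec i j) as [|ne]; [lra|].
    pose proof (offdiag_bound i j _ (d i) (d j) hi hj ne hX). lra. }
  assert (hS : 0 <= S).
  { apply sumR_nonneg. intros j hj. destruct (Nat.eq_dec i j); [lra|].
    apply Rmult_le_pos; [auto|apply q_nonneg]. }
  pose proof (q_nonneg i (d i)) as hq.
  assert (hm : q i (d i) * (alpha i * q i (d i)) <= q i (d i) * S) by lra.
  (* [hm] carries a factor [q i (d i)] on both sides; if it vanishes, the claim is S >= 0. *)
  destruct (Req_dec (q i (d i)) 0) as [e0|ne]; [rewrite e0; lra|].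
  apply Rmult_le_reg_l with (q i (d i)); lra.
Qed.

(** Only player [i] moves, so just the diagonal block survives in the derivative of the slope. One
    mean value argument makes the slope grow at rate at least [c0]; a second, for the payoff minus
    the quadratic with that slope, integrates this. *)
Lemma strong_convexity i x v : (i < I)%nat -> inQ I n Q x -> memQ n Q i v ->
  f i x + own_slope i x (fun k => v k - x i k)
    + alpha i / 2 * (q i (fun k => v k - x i k) * q i (fun k => v k - x i k)) <= f i (upd x i v).
Proof.
  intros hi hx hv. set (y := upd x i v). assert (hy : inQ I n Q y) by (apply inQ_upd; auto).
  set (d := fun k => v k - x i k). set (c0 := alpha i * (q i d * q i d)).
  set (g := fun s => own_slope i (line x (psub y x) s) d).
  assert (hg : forall t, 0 <= t <= 1 -> g 0 + c0 * t <= g t).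
  { intros t [ht0 ht1]. destruct (Req_dec t 0) as [->|ne]; [lra|].
    destruct (MVT_cor2 g (fun t => sumR I (fun j => bilin (n i) (n j)
      (fun k l => D2 i i k j l (line x (psub y x) t)) d (psub y x j))) 0 t) as [c [e hc]]; [lra| |].
    { intros c hc. apply own_slope_derivable; auto. lra. }
    assert (hX : inQ I n Q (line x (psub y x) c)) by (apply line_psub_inQ; auto; lra).
    rewrite (sumR_single I i) in e; auto.
    - replace (psub y x i) with d in e
        by (apply functional_extensionality; intros; unfold d, psub, y; rewrite upd_same; auto).
      pose proof (diag_bound i _ d hi hX) as hd. fold c0 in hd. nra.
    - intros j hj. apply sumR_0. intros k _. apply sumR_0. intros l _.
      unfold psub, y. rewrite upd_other by auto. ring. }
  destruct (MVT_cor2 (fun s => f i (line x (psub y x) s) - (g 0 * s + c0 / 2 * (s * s)))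
     (fun s => g s - (g 0 * 1 + c0 / 2 * (1 * s + s * 1))) 0 1) as [c [e hc]]; [lra| |].
  { intros c hc.
    apply (derivable_pt_lim_minus (fun s => f i (line x (psub y x) s))
             (fun s => g 0 * s + c0 / 2 * (s * s))).
    - apply payoff_derivable_own; auto.
    - apply (derivable_pt_lim_plus (fun s => g 0 * s) (fun s => c0 / 2 * (s * s))).
      + apply (derivable_pt_lim_scal id), derivable_pt_lim_id.
      + apply (derivable_pt_lim_scal (fun s => s * s)).
        apply (derivable_pt_lim_mult id id); apply derivable_pt_lim_id. }
  rewrite line_psub_1, line_0 in e.
  specialize (hg c ltac:(lra)).
  assert (hg0 : g 0 = own_slope i x d) by (unfold g; rewrite line_0; reflexivity).
  unfold c0 in *. rewrite <- hg0. fold y. lra.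
Qed.

Lemma own_slope_bound i x : (i < I)%nat ->
  exists G, 0 <= G /\ forall d r, (forall k, (k < n i)%nat -> Rabs (d k) <= r) ->
    - (G * r) <= own_slope i x d.
Proof.
  intros hi. exists (sumR (n i) (fun k => Rabs (D1 i i k x))).
  split; [apply sumR_nonneg; intros; apply Rabs_pos|].
  intros d r h. unfold own_slope, dot.
  pose proof (sumR_Rabs (n i) (fun k => D1 i i k x * d k)) as h1.
  assert (h2 : sumR (n i) (fun k => Rabs (D1 i i k x * d k))
     <= sumR (n i) (fun k => Rabs (D1 i i k x)) * r).
  { rewrite <- sumR_scal_r. apply sumR_le. intros k hk. rewrite Rabs_mult.
    apply Rmult_le_compat_l; [apply Rabs_pos|auto]. }
  pose proof (Rle_abs (- sumR (n i) (fun k => D1 i i k x * d k))) as h3.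
  rewrite Rabs_Ropp in h3. lra.
Qed.

(** * Existence of best responses *)

Definition best_response (i : nat) (x : prof) (u : vec) : Prop :=
  memQ n Q i u /\ forall y, memQ n Q i y -> f i (upd x i u) <= f i (upd x i y).

Lemma upd_upd x i u v : upd (upd x i u) i v = upd x i v.
Proof.
  apply functional_extensionality. intros j. unfold upd. destruct (Nat.eq_dec j i); reflexivity.
Qed.

Lemma best_response_plays_best i x u : best_response i x u -> plays_best i (upd x i u).
Proof. intros [_ h] y hy. rewrite upd_upd. auto. Qed.

(* Strong convexity makes every minimising sequence Cauchy, so no compactness is needed. *)
Lemma best_response_exists i x : (i < I)%nat -> inQ I n Q x -> exists u, best_response i x u.
Proof.
  intros hi hx. set (h := fun u => f i (upd x i u)).
  assert (tangent : forall u v, memQ n Q i u -> memQ n Q i v ->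
    h u + own_slope i (upd x i u) (fun k => v k - u k)
      + alpha i / 2 * (q i (fun k => v k - u k) * q i (fun k => v k - u k)) <= h v).
  { intros u v hu hv. pose proof (strong_convexity i (upd x i u) v hi) as hs.
    rewrite upd_upd, upd_same in hs. apply hs; auto. apply inQ_upd; auto. }
  pose proof (alpha_pos i hi) as ha.
  destruct (Q_nonempty i hi) as [u0 hu0].
  (* [completeness] yields suprema, so the infimum of [h] is taken as minus the supremum of
     [- h]. *)
  destruct (completeness (fun r => exists u, memQ n Q i u /\ r = - h u)) as [s [hub hlub]].
  { destruct (own_slope_bound i (upd x i u0) hi) as [G [hG hslope]].
    set (G' := G * K i).
    exists (- h u0 + G' * G' / (2 * alpha i)). intros r [u [hu ->]].
    pose proof (tangent u0 u hu0 hu) as ht.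
    set (qq := q i (fun k => u k - u0 k)) in *.
    pose proof (hslope (fun k => u k - u0 k) (K i * qq)
                  (fun k hk => q_coord i (fun k => u k - u0 k) k hi hk)) as hs.
    replace (G * (K i * qq)) with (G' * qq) in hs by (unfold G'; ring).
    (* Completing the square in alpha/2 qq^2 - G' qq, whose least value is - G'^2 / (2 alpha),
       bounds [h] from below. *)
    assert (hsq : 0 <= alpha i / 2 * ((qq - G' / alpha i) * (qq - G' / alpha i)))
      by (apply Rmult_le_pos; [lra|apply Rle_0_sqr]).
    replace (alpha i / 2 * ((qq - G' / alpha i) * (qq - G' / alpha i)))
      with (alpha i / 2 * (qq * qq) - G' * qq + G' * G' / (2 * alpha i)) in hsq by (field; lra).
    lra. }
  { exists (- h u0), u0. auto. }
  set (m := - s).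
  assert (hm : forall u, memQ n Q i u -> m <= h u).
  { intros u hu. assert (- h u <= s) by (apply hub; exists u; auto). unfold m; lra. }
  destruct (choice (fun (p : nat) u => memQ n Q i u /\ h u < m + / (INR p + 1))) as [u hu].
  { intros p. pose proof (pos_INR p) as hp.
    assert (hpi : 0 < / (INR p + 1)) by (apply Rinv_0_lt_compat; lra).
    apply NNPP. intros hn. assert (s <= s - / (INR p + 1)); [|lra].
    apply hlub. intros r [u [hu ->]]. apply Rnot_lt_le. intros hlt. apply hn.
    exists u. split; [auto|]. unfold m. lra. }
  assert (hq : forall p r, alpha i / 4 * (q i (fun k => u p k - u r k) * q i (fun k => u p k - u r k))
     <= / (INR p + 1) + / (INR r + 1)).
  { intros p r. destruct (hu p) as [hp hp']. destruct (hu r) as [hr hr'].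
    set (mid := fun k => /2 * u p k + (1 - /2) * u r k).
    assert (hmid : memQ n Q i mid) by (apply Q_convex; auto; lra).
    pose proof (hm mid hmid) as hmm.
    pose proof (tangent mid (u p) hmid hp) as t1.
    pose proof (tangent mid (u r) hmid hr) as t2.
    set (qq := q i (fun k => u p k - u r k)).
    assert (e1 : q i (fun k => u p k - mid k) = /2 * qq).
    { rewrite (q_ext i _ (fun k => /2 * (u p k - u r k))) by (intros; unfold mid; field).
      rewrite (q_scal i (/2) (fun k => u p k - u r k)), Rabs_pos_eq by lra. reflexivity. }
    assert (e2 : q i (fun k => u r k - mid k) = /2 * qq).
    { rewrite (q_ext i _ (fun k => - /2 * (u p k - u r k))) by (intros; unfold mid; field).
      rewrite (q_scal i (-/2) (fun k => u p k - u r k)), Rabs_left by lra. unfold qq; ring. }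
    rewrite e1 in t1. rewrite e2 in t2.
    assert (e3 : own_slope i (upd x i mid) (fun k => u r k - mid k)
        = -1 * own_slope i (upd x i mid) (fun k => u p k - mid k)).
    { unfold own_slope, dot. rewrite <- sumR_scal. apply sumR_ext. intros. unfold mid. field. }
    rewrite e3 in t2. lra. }
  destruct (closed_Cauchy_limit (n i) (memQ n Q i) u (Q_closed i hi)) as [v [hvR [hv hlim]]].
  { intros p; apply hu. }
  { intros k hk eps heps.
    set (e := alpha i / 4 * (eps / (Rabs (K i) + 1) * (eps / (Rabs (K i) + 1)))).
    pose proof (Rabs_pos (K i)) as hKp.
    assert (hek : 0 < eps / (Rabs (K i) + 1)) by (apply Rdiv_lt_0_compat; lra).
    assert (he : 0 < e) by (unfold e; apply Rmult_lt_0_compat; nra).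
    destruct (archimed_cor1 (e / 2)) as [N [hN hN0]]; [lra|].
    assert (hinv : forall p, (p >= N)%nat -> / (INR p + 1) < e / 2).
    { intros p hp. eapply Rle_lt_trans; [|exact hN]. apply Rinv_le_contravar.
      - apply lt_0_INR; auto.
      - apply le_INR in hp. lra. }
    exists N. intros p r hp hr. unfold Rdist.
    eapply Rle_lt_trans; [apply (q_coord i (fun k => u p k - u r k) k hi hk)|].
    pose proof (q_nonneg i (fun k => u p k - u r k)) as hq0.
    specialize (hq p r). pose proof (hinv p hp). pose proof (hinv r hr).
    set (qq := q i (fun k => u p k - u r k)) in *.
    set (b := eps / (Rabs (K i) + 1)) in *.
    assert (hqb : qq < b).
    { apply Rnot_le_lt. intros hle. assert (b * b <= qq * qq) by nra.
      assert (alpha i / 4 * (b * b) <= alpha i / 4 * (qq * qq)) by (apply Rmult_le_compat_l; lra).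
      unfold e in *. lra. }
    assert (eb : b * (Rabs (K i) + 1) = eps) by (unfold b; field; lra).
    pose proof (Rle_abs (K i)). nra. }
  exists v. split; [exact hv|]. intros y hy. apply Rle_trans with m; [|apply hm; auto].
  fold (h v). apply Rnot_lt_le. intros hlt.
  (* The tangent inequality at [v] acts as lower semicontinuity: h (u p) >= h v - G r when the
     coordinates of u p - v are at most r. Half of [gap] pays for the slope, half for the excess of
     h (u p) over [m]. *)
  destruct (own_slope_bound i (upd x i v) hi) as [G [hG hslope]].
  set (gap := h v - m) in *.
  destruct (hlim (gap / (2 * (G + 1)))) as [N hN]; [apply Rdiv_lt_0_compat; unfold gap; lra|].
  destruct (archimed_cor1 (gap / 2)) as [N' [hN' hN0]]; [unfold gap; lra|].
  set (p := Nat.max N N').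
  pose proof (hslope (fun k => u p k - v k) _ (hN p ltac:(lia))) as hs.
  destruct (hu p) as [hp hp'].
  pose proof (tangent v (u p) hv hp) as ht.
  assert (hi' : / (INR p + 1) < gap / 2).
  { eapply Rle_lt_trans; [|exact hN']. apply Rinv_le_contravar; [apply lt_0_INR; auto|].
    assert (hle : (N' <= p)%nat) by (unfold p; lia). apply le_INR in hle. lra. }
  assert (G * (gap / (2 * (G + 1))) <= gap / 2).
  { apply Rmult_le_reg_r with (2 * (G + 1)); [lra|].
    replace (G * (gap / (2 * (G + 1))) * (2 * (G + 1))) with (G * gap) by (field; lra).
    unfold gap in *. nra. }
  assert (0 <= alpha i / 2 * (q i (fun k => u p k - v k) * q i (fun k => u p k - v k)))
    by (apply Rmult_le_pos; [lra|apply Rle_0_sqr]).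
  unfold gap in *. lra.
Qed.

(** * Contraction and uniqueness *)

Definition within (B : R) (x y : prof) : Prop :=
  forall j, (j < I)%nat -> q j (psub x y j) <= B * w j.

(** Closeness is asked of the opponents alone, since a best response ignores the player's own
    component; in the asynchronous scheme the conditions on the delays likewise concern only j <>
    i. *)
Lemma best_response_contraction i x y u v B : (i < I)%nat -> inQ I n Q x -> inQ I n Q y -> 0 <= B ->
  best_response i x u -> best_response i y v ->
  (forall j, (j < I)%nat -> j <> i -> q j (psub x y j) <= B * w j) ->
  q i (fun k => u k - v k) <= rho * B * w i.
Proof.
  intros hi hx hy hB hu hv h.
  pose proof (best_response_comparison i (upd y i v) (upd x i u) hi
    (inQ_upd y i v hy hi (proj1 hv)) (inQ_upd x i u hx hi (proj1 hu))
    (best_response_plays_best i y v hv) (best_response_plays_best i x u hu)) as hc.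
  replace (psub (upd x i u) (upd y i v) i) with (fun k => u k - v k) in hc
    by (unfold psub; rewrite !upd_same; reflexivity).
  assert (hs : sumR I (fun j => if Nat.eq_dec i j then 0 else
       beta i j * q j (psub (upd x i u) (upd y i v) j))
     <= B * sumR I (fun j => if Nat.eq_dec i j then 0 else beta i j * w j)).
  { rewrite <- sumR_scal. apply sumR_le. intros j hj. destruct (Nat.eq_dec i j) as [|ne]; [lra|].
    replace (psub (upd x i u) (upd y i v) j) with (psub x y j)
      by (unfold psub; rewrite !upd_other by auto; reflexivity).
    pose proof (h j hj ltac:(auto)). pose proof (beta_nonneg i j hi hj ne). nra. }
  pose proof (contraction i hi). pose proof (alpha_pos i hi).
  apply Rmult_le_reg_l with (alpha i); [auto|]. nra.
Qed.

Lemma within_exists x y : exists B, 0 <= B /\ within B x y.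
Proof.
  destruct (finite_upper_bound I (fun j => q j (psub x y j) / w j)) as [B [hB h]].
  exists B. split; [auto|]. intros j hj. specialize (h j hj). pose proof (w_pos j hj).
  apply Rmult_le_compat_r with (r := w j) in h; [|lra].
  unfold Rdiv in h. rewrite Rmult_assoc, Rinv_l, Rmult_1_r in h by lra. exact h.
Qed.

Lemma is_NE_best_response x : is_NE I n Q f x <->
  inQ I n Q x /\ forall i, (i < I)%nat -> best_response i x (x i).
Proof.
  split.
  - intros [hx h]. split; [auto|]. intros i hi. split; [apply inQ_memQ; auto|].
    rewrite upd_id. apply h; auto.
  - intros [hx h]. split; [auto|]. intros i hi. destruct (h i hi) as [_ h'].
    rewrite upd_id in h'. auto.
Qed.

(** An equilibrium answers itself, so any bound between two of them improves by the factor [rho]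
    indefinitely. Zero padding turns the vanishing distance into equality of profiles. *)
Lemma NE_unique x y : is_NE I n Q f x -> is_NE I n Q f y -> y = x.
Proof.
  rewrite !is_NE_best_response. intros [hx bx] [hy b_y].
  destruct (within_exists y x) as [B [hB h0]].
  assert (hpow : forall k, 0 <= B * rho ^ k)
    by (intros k; apply Rmult_le_pos; [auto|apply pow_le; lra]).
  assert (h : forall k, within (B * rho ^ k) y x).
  { induction k as [|k IH]; [simpl; rewrite Rmult_1_r; auto|].
    intros j hj. replace (B * rho ^ S k) with (rho * (B * rho ^ k)) by (simpl; ring).
    apply (best_response_contraction j y x); auto. }
  apply functional_extensionality. intros i.
  destruct (Nat.lt_ge_cases i I) as [hi|hi].
  - apply (q_zero i); [auto|apply (inQ_memQ y); auto|apply (inQ_memQ x); auto|].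
    apply (le_0_of_geometric _ (B * w i) rho rho_lt). intros k.
    specialize (h k i hi). unfold psub in h. lra.
  - apply functional_extensionality. intros k. rewrite !inQ_outside; auto.
Qed.

Lemma within_trans A B x y z : within A x y -> within B y z -> within (A + B) x z.
Proof.
  intros h1 h2 j hj. specialize (h1 j hj). specialize (h2 j hj).
  pose proof (q_triang j (x j) (y j) (z j)). unfold psub in *. nra.
Qed.

(** * Existence of an equilibrium *)

Lemma best_response_map_exists : exists T : prof -> prof, forall x, inQ I n Q x ->
  inQ I n Q (T x) /\ forall i, (i < I)%nat -> best_response i x (T x i).
Proof.
  apply (choice (fun x y => inQ I n Q x -> inQ I n Q y /\
    forall i, (i < I)%nat -> best_response i x (y i))).
  intros x. destruct (classic (inQ I n Q x)) as [hx|hn]; [|exists x; tauto].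
  destruct (choice (fun i u => ((i < I)%nat -> best_response i x u) /\
     ((I <= i)%nat -> forall k, u k = 0))) as [y hy].
  { intros i. destruct (Nat.lt_ge_cases i I) as [hi|hi].
    - destruct (best_response_exists i x hi hx) as [u hu]. exists u. split; [auto|lia].
    - exists (fun _ => 0). split; [lia|auto]. }
  exists y. intros _. split; [|intros i; apply hy].
  apply memQ_inQ; [intros i hi; apply hy; auto|intros i; apply hy].
Qed.

Lemma NE_exists : exists xs, is_NE I n Q f xs.
Proof.
  destruct best_response_map_exists as [T hT].
  destruct inQ_nonempty as [x0 h0].
  set (x := fun p => Nat.iter p T x0).
  assert (hx : forall p, inQ I n Q (x p)).
  { induction p as [|p IH]; [exact h0|]. apply (hT (x p) IH). }
  destruct (within_exists (x 1%nat) (x 0%nat)) as [B [hB hB1]].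
  assert (hpow : forall p, 0 <= B * rho ^ p)
    by (intros p; apply Rmult_le_pos; [auto|apply pow_le; lra]).
  assert (contr : forall y z C, inQ I n Q y -> inQ I n Q z -> 0 <= C -> within C y z ->
     within (rho * C) (T y) (T z)).
  { intros y z C hy hz hC h j hj.
    apply (best_response_contraction j y z); auto; apply hT; auto. }
  assert (hstep : forall p, within (B * rho ^ p) (x (S p)) (x p)).
  { induction p as [|p IH]; [simpl; rewrite Rmult_1_r; auto|].
    replace (B * rho ^ S p) with (rho * (B * rho ^ p)) by (simpl; ring).
    apply (contr (x (S p)) (x p)); auto. }
  (* The quotient is the partial geometric sum 1 + rho + ... + rho^(r-1) of the single-step
     bounds. *)
  assert (hfar : forall p r, within (B * rho ^ p * ((1 - rho ^ r) / (1 - rho))) (x (r + p)%nat) (x p)).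
  { intros p. induction r as [|r IH].
    - intros j hj. simpl. unfold psub. rewrite q_self.
      replace ((1 - 1) / (1 - rho)) with 0 by (field; lra). lra.
    - replace (B * rho ^ p * ((1 - rho ^ S r) / (1 - rho)))
        with (B * rho ^ (r + p) + B * rho ^ p * ((1 - rho ^ r) / (1 - rho)))
        by (rewrite pow_add; simpl; field; lra).
      apply within_trans with (x (r + p)%nat); auto. }
  set (B' := B / (1 - rho)).
  assert (hB' : 0 <= B') by (apply Rmult_le_pos; [auto|left; apply Rinv_0_lt_compat; lra]).
  assert (hfar' : forall p r, (p <= r)%nat -> within (B' * rho ^ p) (x r) (x p)).
  { intros p r hpr j hj. replace r with ((r - p) + p)%nat by lia.
    eapply Rle_trans; [apply (hfar p (r - p)%nat j hj)|].
    pose proof (w_pos j hj). apply Rmult_le_compat_r; [lra|].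
    assert (0 <= rho ^ p) by (apply pow_le; lra).
    assert (0 <= rho ^ (r - p)) by (apply pow_le; lra).
    replace (B * rho ^ p * ((1 - rho ^ (r - p)) / (1 - rho)))
      with (B' * rho ^ p * (1 - rho ^ (r - p))) by (unfold B'; field; lra).
    assert (0 <= B' * rho ^ p) by (apply Rmult_le_pos; auto). nra. }
  destruct (choice (fun i v => ((I <= i)%nat -> forall k, v k = 0) /\ ((i < I)%nat ->
      memQ n Q i v /\ forall eps, eps > 0 -> exists N, forall p, (N <= p)%nat ->
         forall k, (k < n i)%nat -> Rabs (x p i k - v k) <= eps))) as [xs hxs].
  { intros i. destruct (Nat.lt_ge_cases i I) as [hi|hi];
      [|exists (fun _ => 0); split; [auto|lia]].
    destruct (closed_Cauchy_limit (n i) (memQ n Q i) (fun p => x p i) (Q_closed i hi))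
      as [v [_ [hv hlim]]].
    - intros p. apply inQ_memQ; auto.
    - intros k hk eps heps. set (M := Rabs (K i) * (B' * w i)).
      pose proof (w_pos i hi) as hw. pose proof (Rabs_pos (K i)) as hKp.
      assert (hM : 0 <= M) by (apply Rmult_le_pos; [auto|nra]).
      destruct (pow_lt_1_zero rho) with (y := eps / (M + 1)) as [N hN];
        [rewrite Rabs_pos_eq; lra|apply Rdiv_lt_0_compat; lra|].
      assert (key : forall p r, (N <= p)%nat -> (p <= r)%nat -> Rabs (x r i k - x p i k) < eps).
      { intros p r hp hr.
        eapply Rle_lt_trans; [apply (q_coord i (fun k => x r i k - x p i k) k hi hk)|].
        pose proof (hfar' p r hr i hi) as hf. unfold psub in hf.
        pose proof (q_nonneg i (fun k => x r i k - x p i k)) as hq.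
        specialize (hN p hp). assert (hrp : 0 <= rho ^ p) by (apply pow_le; lra).
        rewrite Rabs_pos_eq in hN by auto.
        apply Rle_lt_trans with (M * rho ^ p).
        - apply Rle_trans with (Rabs (K i) * (B' * rho ^ p * w i)); [|unfold M; right; ring].
          apply Rle_trans with (Rabs (K i) * q i (fun k => x r i k - x p i k)).
          + apply Rmult_le_compat_r; [auto|apply Rle_abs].
          + apply Rmult_le_compat_l; auto.
        - assert (e : (M + 1) * (eps / (M + 1)) = eps) by (field; lra). nra. }
      exists N. intros p r hp hr. unfold Rdist.
      destruct (Nat.le_ge_cases p r); [rewrite Rabs_minus_sym|]; apply key; lia.
    - exists v. split; [lia|auto]. }
  assert (hxsQ : inQ I n Q xs).
  { apply memQ_inQ; [intros i hi; apply (proj2 (hxs i) hi)|intros i; apply hxs]. }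
  (* Completeness gave convergence of coordinates; [q_upper] converts it back to the weighted norms
     in which the map contracts. *)
  assert (hconv : forall eps, eps > 0 -> exists N, forall p, (N <= p)%nat -> within eps (x p) xs).
  { intros eps heps.
    destruct (finite_common_index I (fun j N => forall p, (N <= p)%nat ->
       q j (psub (x p) xs j) <= eps * w j)) as [N hN].
    - intros k N N' h hle p hp. apply h; lia.
    - intros j hj. pose proof (w_pos j hj). pose proof (Rabs_pos (L j)).
      assert (hr : eps * w j / (Rabs (L j) + 1) > 0) by (apply Rdiv_lt_0_compat; nra).
      destruct (proj2 (proj2 (hxs j) hj) _ hr) as [N hN].
      exists N. intros p hp.
      eapply Rle_trans; [apply (q_upper j _ _ hj (Rlt_le _ _ hr)); apply hN; auto|].
      pose proof (Rle_abs (L j)).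
      set (r := eps * w j / (Rabs (L j) + 1)) in *.
      assert (e : r * (Rabs (L j) + 1) = eps * w j) by (unfold r; field; lra). nra.
    - exists N. intros p hp j hj. apply hN; auto. }
  exists xs. apply is_NE_best_response. split; [auto|].
  assert (hfix : forall i, (i < I)%nat -> T xs i = xs i).
  { intros i hi. apply (q_zero i); [auto|apply (inQ_memQ (T xs)); auto; apply hT; auto|
      apply (inQ_memQ xs); auto|].
    apply Rnot_lt_le. intros hlt. set (a := q i (fun k => T xs i k - xs i k)) in *.
    pose proof (w_pos i hi) as hw.
    (* Passing through x (S N), the distance a is at most rho e w_i + e w_i <= a / 2, a
       contradiction. *)
    set (e := a / (4 * w i)). assert (he : e > 0) by (apply Rdiv_lt_0_compat; lra).
    destruct (hconv e he) as [N hN].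
    pose proof (contr (x N) xs e (hx N) hxsQ ltac:(lra) (hN N (le_n N)) i hi) as c1.
    pose proof (hN (S N) ltac:(lia) i hi) as c2.
    change (T (x N)) with (x (S N)) in c1. unfold psub in c1, c2.
    rewrite q_sub_sym in c1.
    pose proof (q_triang i (T xs i) (x (S N) i) (xs i)) as c3. fold a in c3.
    assert (ew : e * w i = a / 4) by (unfold e; field; lra). nra. }
  intros i hi. rewrite <- (hfix i hi). apply hT; auto.
Qed.

(** * Convergence of the asynchronous iteration *)

Lemma async_converges xs T tau x : is_NE I n Q f xs ->
  sched_A1 I tau -> sched_A2 I T tau -> sched_A3 I T -> async_BR I n Q f T tau x ->
  forall eps, eps > 0 -> exists N, forall m, (N <= m)%nat -> pdist I n (x m) xs < eps.
Proof.
  rewrite is_NE_best_response. intros [hxs hbr] hA1 hA2 hA3 [hx0 hx].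
  assert (hmem : forall m i, (i < I)%nat -> memQ n Q i (x m i)).
  { induction m as [|m IH]; intros i hi; [apply inQ_memQ; auto|].
    destruct (proj2 (hx m i) hi) as [h1 h2].
    destruct (classic (T i m)) as [ht|ht]; [apply h1; auto|rewrite h2; auto]. }
  assert (hout : forall m i, (I <= i)%nat -> forall k, x m i k = 0).
  { induction m as [|m IH]; intros i hi k; [apply inQ_outside; auto|].
    rewrite (proj1 (hx m i) hi). auto. }
  assert (step : forall i m B, (i < I)%nat -> T i m -> 0 <= B ->
    (forall j, (j < I)%nat -> j <> i -> q j (psub (x (tau i j m)) xs j) <= B * w j) ->
    q i (psub (x (S m)) xs i) <= rho * B * w i).
  { intros i m B hi ht hB h.
    apply (best_response_contraction i (fun j => x (tau i j m) j) xs); auto.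
    - apply memQ_inQ; intros j hj; auto.
    - apply (proj2 (hx m i) hi); auto. }
  assert (stay : forall i m, (i < I)%nat -> ~ T i m -> psub (x (S m)) xs i = psub (x m) xs i).
  { intros i m hi ht. unfold psub. rewrite (proj2 (proj2 (hx m i) hi) ht). reflexivity. }
  destruct (within_exists (x 0%nat) xs) as [B [hB hB0]].
  (* The induction covers all earlier times at once because an update may use any past iterate; A1
     keeps it from using a future one. *)
  assert (hall : forall m m', (m' <= m)%nat -> within B (x m') xs).
  { induction m as [|m IH]; intros m' hm'.
    - replace m' with 0%nat by lia. auto.
    - destruct (Nat.eq_dec m' (S m)) as [->|]; [|apply IH; lia]. intros i hi.
      destruct (classic (T i m)) as [ht|ht]; [|rewrite stay by auto; apply (IH m); auto].
      apply Rle_trans with (rho * B * w i).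
      + apply step; auto. intros j hj ne. apply (IH (tau i j m)); auto.
      + pose proof (w_pos i hi). apply Rmult_le_compat_r; [lra|nra]. }
  (* One shrinking of the box: after some time player [i] only uses data no older than N, and after
     its next update it is in the smaller box, where later updates and idle steps keep it. *)
  assert (phase : forall C N, 0 <= C -> (forall m, (N <= m)%nat -> within C (x m) xs) ->
     exists N', forall m, (N' <= m)%nat -> within (rho * C) (x m) xs).
  { intros C N hC hN.
    destruct (finite_common_index I (fun i N' => forall m, (N' <= m)%nat ->
      q i (psub (x m) xs i) <= rho * C * w i)) as [N' hN'].
    - intros k N1 N2 h hle m hm. apply h; lia.
    - intros i hi.
      destruct (finite_common_index I (fun j N1 => forall m, (N1 <= m)%nat -> T i m -> j <> i ->
         (N <= tau i j m)%nat)) as [N1 hN1].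
      + intros k N1 N2 h hle m hm. apply h; lia.
      + intros j hj. apply NNPP. intros hn.
        destruct (Nat.eq_dec j i) as [->|ne]; [apply hn; exists 0%nat; congruence|].
        (* If stale data recurred forever, these update times n_k >= k would tend to infinity while
           tau stays below N, against A2. *)
        destruct (choice (fun k m => (k <= m)%nat /\ T i m /\ (tau i j m < N)%nat)) as [nk hnk].
        { intros k. apply NNPP. intros hn'. apply hn. exists k. intros m hm ht _.
          destruct (Nat.le_gt_cases N (tau i j m)); auto. exfalso; apply hn'. exists m; auto. }
        destruct (hA2 i j hi hj ne nk (fun k => proj1 (proj2 (hnk k)))) with (M := N) as [k0 hk0].
        * intros M. exists M. intros k hk. pose proof (proj1 (hnk k)). lia.
        * specialize (hk0 k0 (le_n k0)). pose proof (proj2 (proj2 (hnk k0))). lia.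
      + destruct (hA3 i hi N1) as [m0 [hm0 ht0]].
        assert (hup : forall m, (N1 <= m)%nat -> T i m -> q i (psub (x (S m)) xs i) <= rho * C * w i).
        { intros m hm ht. apply step; auto. intros j hj ne. apply (hN (tau i j m)); auto. }
        (* The update at time [m0], supplied by A3, takes effect in the iterate of index S m0. *)
        exists (S m0). intros m hm. induction hm as [|m hm IH]; [apply hup; auto|].
        destruct (classic (T i m)) as [ht|ht]; [apply hup; [lia|auto]|rewrite stay; auto].
    - exists N'. intros m hm i hi. apply hN'; auto. }
  assert (hgeo : forall k, exists N, forall m, (N <= m)%nat -> within (B * rho ^ k) (x m) xs).
  { induction k as [|k [N hN]].
    - exists 0%nat. intros m _. simpl. rewrite Rmult_1_r. apply (hall m); auto.
    - replace (B * rho ^ S k) with (rho * (B * rho ^ k)) by (simpl; ring).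
      apply (phase _ N); auto. apply Rmult_le_pos; [auto|apply pow_le; lra]. }
  intros eps heps.
  destruct (pdist_small I n eps heps) as [r [hr hrd]].
  destruct (finite_upper_bound I (fun i => Rabs (K i) * (B * w i))) as [M [hM hMb]].
  destruct (pow_lt_1_zero rho) with (y := r / (M + 1)) as [k hk];
    [rewrite Rabs_pos_eq; lra|apply Rdiv_lt_0_compat; lra|].
  specialize (hk k (le_n k)). assert (hrk : 0 <= rho ^ k) by (apply pow_le; lra).
  rewrite Rabs_pos_eq in hk by auto.
  destruct (hgeo k) as [N hN]. exists N. intros m hm. apply hrd. intros i l.
  destruct (Nat.lt_ge_cases i I) as [hi|hi].
  - destruct (Nat.lt_ge_cases l (n i)) as [hl|hl].
    + eapply Rle_lt_trans; [apply (q_coord i (psub (x m) xs i) l hi hl)|].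
      specialize (hN m hm i hi). specialize (hMb i hi).
      pose proof (q_nonneg i (psub (x m) xs i)) as hq. pose proof (Rabs_pos (K i)) as hKp.
      apply Rle_lt_trans with (M * rho ^ k).
      * apply Rle_trans with (Rabs (K i) * (B * rho ^ k * w i)).
        -- apply Rle_trans with (Rabs (K i) * q i (psub (x m) xs i)).
           ++ apply Rmult_le_compat_r; [auto|apply Rle_abs].
           ++ apply Rmult_le_compat_l; auto.
        -- replace (Rabs (K i) * (B * rho ^ k * w i)) with (Rabs (K i) * (B * w i) * rho ^ k) by ring.
           apply Rmult_le_compat_r; auto.
      * assert (e : (M + 1) * (r / (M + 1)) = r) by (field; lra). nra.
    + rewrite (proj1 (hmem m i hi) l hl), (proj1 (inQ_memQ xs i hxs hi) l hl).
      rewrite Rminus_0_r, Rabs_R0. auto.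
  - rewrite hout, (inQ_outside xs) by auto. rewrite Rminus_0_r, Rabs_R0. auto.
Qed.

End Game.

(** * Norms from the scaling matrices, and assembly *)

Lemma scaled_norm_exists m C : nonsing m C ->
  exists D K L,
    (forall v k, (k < m)%nat -> matvec m C (matvec m D v) k = v k) /\
    (forall v k, (k < m)%nat -> Rabs (v k) <= K * norm2 m (matvec m D v)) /\
    (forall v r, 0 <= r -> (forall k, (k < m)%nat -> Rabs (v k) <= r) ->
       norm2 m (matvec m D v) <= L * r).
Proof.
  intros hC. destruct (nonsing_right_inverse m C hC) as [D hD].
  destruct (matvec_bounded m m C) as [K [_ hK]].
  destruct (matvec_bounded m m D) as [K' [hK'0 hK']].
  exists D, K, (K' * INR m). split; [exact hD|]. split.
  (* Writing v = C (D v) turns the operator bound of C into control of the coordinates by the scaled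
     norm. *)
  - intros v k hk. rewrite <- (hD v k hk) at 1.
    eapply Rle_trans; [apply (norm2_coord m _ k hk)|apply hK].
  - intros v r hr h. eapply Rle_trans; [apply hK'|]. rewrite Rmult_assoc.
    apply Rmult_le_compat_l; [lra|]. apply norm2_le_coord; auto.
Qed.

Theorem mainTheorem3 (I : nat) (n : nat -> nat) (Q : nat -> vec -> Prop) (f : nat -> prof -> R) :
  PUps_NEP I n Q f ->
  exists xs : prof,
    is_NE I n Q f xs /\
    (forall y, is_NE I n Q f y -> y = xs) /\
    (forall (T : nat -> nat -> Prop) (tau : nat -> nat -> nat -> nat) (x : nat -> prof),
       sched_A1 I tau -> sched_A2 I T tau -> sched_A3 I T -> async_BR I n Q f T tau x ->
       forall eps : R, eps > 0 -> exists N : nat, forall m : nat, (N <= m)%nat -> pdist I n (x m) xs < eps).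
Proof.
  intros [hn [[hQ _] [U [D1 [D2 [hU [hQU [hUE [hC [_ [C [alpha [beta [hns [halpha [hbeta hP]]]]]]]]]]]]]]]].
  destruct (choice (fun i (t : (nat -> nat -> R) * R * R) => let '(D, K, L) := t in (i < I)%nat ->
    (forall v k, (k < n i)%nat -> matvec (n i) (C i) (matvec (n i) D v) k = v k) /\
    (forall v k, (k < n i)%nat -> Rabs (v k) <= K * norm2 (n i) (matvec (n i) D v)) /\
    (forall v r, 0 <= r -> (forall k, (k < n i)%nat -> Rabs (v k) <= r) ->
       norm2 (n i) (matvec (n i) D v) <= L * r))) as [t ht].
  { intros i. destruct (Nat.lt_ge_cases i I) as [hi|hi].
    - destruct (scaled_norm_exists (n i) (C i) (hns i hi)) as [D [K [L h]]].
      exists (D, K, L). auto.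
    - exists (fun _ _ => 0, 0, 0). lia. }
  set (Dm := fun i => fst (fst (t i))). set (K := fun i => snd (fst (t i))).
  set (L := fun i => snd (t i)).
  assert (hD : forall i, (i < I)%nat ->
    (forall v k, (k < n i)%nat -> matvec (n i) (C i) (matvec (n i) (Dm i) v) k = v k) /\
    (forall v k, (k < n i)%nat -> Rabs (v k) <= K i * q n Dm i v) /\
    (forall v r, 0 <= r -> (forall k, (k < n i)%nat -> Rabs (v k) <= r) -> q n Dm i v <= L i * r)).
  { intros i hi. specialize (ht i). unfold q, Dm, K, L. destruct (t i) as [[D k] l]. auto. }
  assert (q_coord := fun i v k hi => proj1 (proj2 (hD i hi)) v k).
  assert (q_upper := fun i v r hi => proj2 (proj2 (hD i hi)) v r).
  assert (Q_nonempty := fun i hi => proj1 (hQ i hi)).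
  assert (Q_closed := fun i hi => proj1 (proj2 (hQ i hi))).
  assert (Q_convex := fun i hi => proj2 (proj2 (hQ i hi))).
  assert (beta_nonneg : forall i j, (i < I)%nat -> (j < I)%nat -> i <> j -> 0 <= beta i j).
  (* An upper bound of an empty set could be negative; a profile in Q and a spectral norm at it
     provide a nonnegative member. *)
  { intros i j hi hj ne. destruct (inQ_nonempty I n Q Q_nonempty) as [x hx].
    destruct (is_norm2_exists (n i) (n j) (blk n C D2 i j x) (hn j hj)) as [s hs].
    apply Rle_trans with s; [apply (is_norm2_nonneg _ _ _ _ (hn j hj) hs)|].
    apply (hbeta i j hi hj ne). exists x; auto. }
  assert (diag_bound : forall i x d, (i < I)%nat -> inQ I n Q x ->
    alpha i * (q n Dm i d * q n Dm i d) <= bilin (n i) (n i) (fun k l => D2 i i k i l x) d d).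
  (* With z = C_i^-1 d the scaled block at z equals the unscaled one at d, and its Rayleigh bound is
     at least [alpha i]. *)
  { intros i x d hi hx. set (z := matvec (n i) (Dm i) d).
    destruct (is_lambda_least_exists (n i) (blk n C D2 i i x) (hn i hi)) as [lam [hl1 hl2]].
    assert (alpha i <= lam) by (apply (halpha i hi); exists x; auto).
    specialize (hl2 z). unfold q. fold z. rewrite norm2_sq.
    replace (bilin (n i) (n i) _ d d) with (quad (n i) (blk n C D2 i i x) z).
    - pose proof (dot_self_nonneg (n i) z). nra.
    - unfold quad. rewrite dot_blk. apply bilin_ext; intros k hk; apply (hD i hi); auto. }
  assert (offdiag_bound : forall i j x u v, (i < I)%nat -> (j < I)%nat -> i <> j -> inQ I n Q x ->
    - (beta i j * (q n Dm i u * q n Dm j v))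
      <= bilin (n i) (n j) (fun k l => D2 i i k j l x) u v).
  { intros i j x u v hi hj ne hx. unfold q.
    set (z := matvec (n i) (Dm i) u). set (y := matvec (n j) (Dm j) v).
    destruct (is_norm2_exists (n i) (n j) (blk n C D2 i j x) (hn j hj)) as [s hs].
    assert (hsb : s <= beta i j) by (apply (hbeta i j hi hj ne); exists x; auto).
    replace (bilin (n i) (n j) _ u v) with (dot (n i) z (matvec (n j) (blk n C D2 i j x) y)).
    - pose proof (is_norm2_bound _ _ _ _ y hs) as h1.
      pose proof (Cauchy_Schwarz (n i) z (matvec (n j) (blk n C D2 i j x) y)) as h2.
      set (b := dot (n i) z (matvec (n j) (blk n C D2 i j x) y)) in *.
      pose proof (Rle_abs (- b)) as h3. rewrite Rabs_Ropp in h3.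
      pose proof (norm2_nonneg (n i) z). pose proof (norm2_nonneg (n j) y).
      assert (norm2 (n i) (matvec (n j) (blk n C D2 i j x) y) <= beta i j * norm2 (n j) y) by nra.
      nra.
    - rewrite dot_blk. apply bilin_ext; intros k hk; [apply (hD i hi)|apply (hD j hj)]; auto. }
  destruct (P_Zmatrix_contraction_weights I alpha beta hP beta_nonneg)
    as [alpha_pos [w [rho [rho_lt [w_pos contraction]]]]].
  assert (f_C1 := fun i hi => proj1 (hC i hi)).
  assert (D1_C1 : forall i j l, (i < I)%nat -> vidx I n j l -> C1_with I n U (D1 i j l) (D2 i j l))
    by (intros i j l hi; apply (hC i hi)).
  destruct (NE_exists I n Q f U D1 D2) with (Dm := Dm) (K := K) (L := L) (alpha := alpha)
    (beta := beta) (w := w) (rho := rho) as [xs hxs]; auto.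
  exists xs. split; [exact hxs|]. split.
  - intros y hy.
    apply (NE_unique I n Q f U D1 D2) with (Dm := Dm) (K := K) (alpha := alpha)
      (beta := beta) (w := w) (rho := rho); auto.
  - intros T tau x h1 h2 h3 h4.
    apply (async_converges I n Q f U D1 D2) with (Dm := Dm) (K := K) (alpha := alpha)
      (beta := beta) (w := w) (rho := rho) (T := T) (tau := tau); auto.
Qed.
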